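(* Let $C$ be the middle third Cantor set and let $\mu$ be the $\frac{\log 2}{\log 3}$-dimensional Hausdorff measure restricted to $C$. Let $\mathbf{x}=(x_n)_{n=1}^{\infty}\in(\mathbb{R}/\mathbb{Z})^{\mathbb{N}}$ be an arbitrary sequence. Then for $\mu$-almost every $x\in C$ we have $$\#\left\{1\leq n\leq N: d(T_{2}^{n}(x),x_n)\leq \frac{1}{n^{0.01}}\right\}\sim 2\sum_{n=1}^{N}n^{-0.01}\quad\text{as } N\to\infty.$$
   Context: $T_2:\mathbb{R}/\mathbb{Z}\to\mathbb{R}/\mathbb{Z}$ is the map $T_2(x)=2x \bmod 1$, and $T_2^n$ is its $n$-fold iterate; a point $x\in C\subset[0,1]$ is regarded as an element of $\mathbb{R}/\mathbb{Z}$. $d$ is the standard metric on $\mathbb{R}/\mathbb{Z}$, i.e. the distance between $x$ and $y$ is $\min_{k\in\mathbb{Z}}|x-y+k|$. $F(N)\sim G(N)$ means $F(N)/G(N)\to 1$ as $N\to\infty$. The measure $\mu$ is a probability measure and coincides with the self-similar measure on $C$ giving weights $(1/2,1/2)$ to the maps $x\mapsto x/3$ and $x\mapsto (x+2)/3$. *)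

(* Defs.v *)
From HB Require Import structures.
From mathcomp Require Import all_boot all_order all_algebra.
From mathcomp Require Import generic_quotient ring_quotient.
From mathcomp Require Import ring lra.
From mathcomp Require Import all_classical all_reals all_analysis.

Set Implicit Arguments.
Unset Strict Implicit.
Unset Printing Implicit Defensive.

Import Order.TTheory GRing.Theory Num.Theory.
Import numFieldNormedType.Exports.

Local Open Scope classical_set_scope.
Local Open Scope ring_scope.
Local Open Scope quotient_scope.

Definition integers (R : realType) : zmodClosed R :=
  GRing.ZmodClosed.clone R (@Num.int_num_subdef R) _.

Definition circle (R : realType) := {ideal_quot integers R}.

HB.instance Definition _ (R : realType) := GRing.Zmodule.on (circle R).

Definition to_circle (R : realType) (a : R) : circle R := \pi_(circle R) a.

Definition doubling (R : realType) (x : circle R) : circle R := x *+ 2.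

(* The infimum is a minimum and does not depend on the representatives: see
   circle_dist_le and circle_dist_attained. *)
Definition circle_dist (R : realType) (x y : circle R) : R :=
  inf [set `|repr x - repr y + k%:~R| | k in [set: int]].

Definition cantor_step (R : realType) (A : set R) : set R :=
  (fun x => x / 3) @` A `|` (fun x => (x + 2) / 3) @` A.

Definition cantor_set (R : realType) : set R :=
  \bigcap_(n : nat) iter n (@cantor_step R) `[0, 1]%classic.

Arguments cantor_set R : clear implicits.

(* diam set0 = -oo, and -oo `^ s = 0 in \bar R when s != 0, so empty sets
   contribute nothing to the sums in hausdorff_pre. *)
Definition diam (R : realType) (U : set R) : \bar R :=
  ereal_sup [set `|p.1 - p.2|%:E | p in U `*` U].

Definition hausdorff_pre (R : realType) (s delta : R) (A : set R) : \bar R :=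
  ereal_inf [set (\sum_(0 <= i <oo) diam (U i) `^ s)%E |
    U in [set U : (set R)^nat |
           A `<=` \bigcup_i U i /\ forall i, (diam (U i) <= delta%:E)%E]].

(* s-dimensional Hausdorff outer measure, for s > 0, without normalising
   constant. The supremum over delta > 0 is the limit as delta tends to 0, as
   hausdorff_pre is nonincreasing in delta. *)
Definition hausdorff (R : realType) (s : R) (A : set R) : \bar R :=
  ereal_sup [set hausdorff_pre s delta A | delta in [set delta | 0 < delta]].

(* The domain carries the Borel sigma-algebra, so that {ae cantor_measure R, P}
   says that the complement of P lies in a Borel set B with
   cantor_measure R B = 0. *)
Definition cantor_measure (R : realType) (A : set (measurableTypeR R)) :
  \bar R := hausdorff (ln 2 / ln 3) (A `&` cantor_set R).

Arguments cantor_measure R A : clear implicits.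

Definition hit_count (R : realType) (x : nat -> circle R) (a : R)
    (N : nat) : nat :=
  #|[pred n : 'I_N.+1 | (0 < n)%N &&
      (circle_dist (iter n (@doubling R) (to_circle a)) (x n)
         <= 1 / n%:R `^ (1 / 100))]|.

Section circle_dist_facts.
Variable R : realType.

Lemma to_circle_eq (a b : R) :
  to_circle a = to_circle b <-> exists k : int, a - b = k%:~R.
Proof.
rewrite /to_circle; split=> [/eqP|[k abk]].
  by rewrite piE Quotient.equivE => /intrP.
by apply/eqP; rewrite piE Quotient.equivE abk intr_int.
Qed.

Lemma to_circle_double (a : R) : doubling (to_circle a) = to_circle (2 * a).
Proof. by rewrite /doubling /to_circle mulr_natl raddfMn. Qed.

Lemma repr_to_circle (a : R) : exists k : int, repr (to_circle a) = a + k%:~R.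
Proof.
have /to_circle_eq[k abk] : to_circle (repr (to_circle a)) = to_circle a.
  by rewrite /to_circle reprK.
by exists k; rewrite -abk addrC subrK.
Qed.

Lemma circle_dist_to_circle (a b : R) :
  circle_dist (to_circle a) (to_circle b) =
  inf [set `|a - b + k%:~R| | k in [set: int]].
Proof.
rewrite /circle_dist; congr inf.
have [i ->] := repr_to_circle a; have [j ->] := repr_to_circle b.
apply/seteqP; split=> _ [k _ <-]; [exists (k + i - j)|exists (k - i + j)] => //;
  by congr (`|_|); rewrite !(rmorphD, rmorphN) /=; ring.
Qed.

Lemma circle_dist_le (a b : R) (k : int) :
  circle_dist (to_circle a) (to_circle b) <= `|a - b + k%:~R|.
Proof.
rewrite circle_dist_to_circle; apply: ge_inf; last by exists k.
by exists 0 => _ [j _ <-].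
Qed.

Lemma circle_dist_attained (a b : R) : exists k : int,
  circle_dist (to_circle a) (to_circle b) = `|a - b + k%:~R|.
Proof.
pose m := Num.floor (a - b + 1 / 2); exists (- m).
apply/eqP; rewrite eq_le circle_dist_le /= circle_dist_to_circle.
apply: lb_le_inf; first by exists `|a - b + 0%:~R|, 0.
move=> _ [k _ <-].
have mle : m%:~R <= a - b + 1 / 2 :> R by exact: floor_le.
have mgt : a - b + 1 / 2 < m%:~R + 1 :> R by rewrite -intrD1; exact: floorD1_gt.
rewrite rmorphN /=.
have u_le : `|a - b - m%:~R| <= 1 / 2 by rewrite ler_norml; apply/andP; split; lra.
have [/eqP|km] := eqVneq (k + m) 0.
  by rewrite addr_eq0 => /eqP ->; rewrite rmorphN.
have : 1 <= `|(k + m)%:~R| :> R.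
  by rewrite -intr_norm (_ : 1 = 1%:~R) // ler_int -gtz0_ge1 normr_gt0.
have := ler_normB (a - b + k%:~R) (a - b - m%:~R).
rewrite (_ : a - b + k%:~R - _ = (k + m)%:~R); first by lra.
by rewrite rmorphD /=; ring.
Qed.

End circle_dist_facts.

(* Main.v *)
Require Import Defs.
From mathcomp Require Import all_boot all_order all_algebra.
From mathcomp Require Import zify ring lra.
From mathcomp Require Import all_classical all_reals all_analysis.

Import Order.TTheory GRing.Theory Num.Theory.
Import numFieldNormedType.Exports.

Local Open Scope classical_set_scope.
Local Open Scope ring_scope.

(* Second-moment method along N = j ^ 40, with averages over the 2 ^ M left
   endpoints of the level-M Cantor intervals (M huge) in place of mu.

   The indicator of an arc is majorised by a sum of Fejer kernels of order
   K = j ^ 3 centred at the points of the arc in (1/K) Z. Expanding the square of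
   the resulting discrepancy leaves averages of cos (2 pi t a + phi) over the
   endpoints a, bounded by the Riesz product prod_i |cos (2 pi t / 3 ^ i)|, at
   frequencies t = h (2 ^ n - 2 ^ n') with 0 < |h| < K. Since 4 generates the
   residues congruent to 1 modulo 3 in (Z / 3 ^ m)^*, the numbers k 2 ^ n take
   distinct values modulo 3 ^ m as n runs through 3 ^ (m-1) consecutive
   integers, for k coprime to 3; and the squared Riesz product of length m has
   sum (3/2) ^ m over Z / 3 ^ m. So it is small on average over n, by a power
   of N.

   By Chebyshev's inequality, a proportion O(j ^ -2) of the level-M intervals is
   bad. Intervals of length 3 ^ -M contribute 2 ^ -M to the sums defining the
   (log 2 / log 3)-dimensional Hausdorff measure, so the limsup of the bad
   intervals is null: only upper bounds on Hausdorff measure are needed. Off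
   this set the upper bound on the number of hits holds for all large j. Applied
   also to the complementary arcs it yields the lower bound, and monotonicity in
   N fills the gaps between j ^ 40 and (j+1) ^ 40. *)

(** * Cosine sums and the Fejer kernel *)

Section cosine_sums.
Variable R : realType.
Implicit Types (x y b delta m : R) (n : nat) (k : int).

Lemma cosD2piz x k : cos (x + 2 * pi * k%:~R) = cos x.
Proof.
have step n y : cos (y + 2 * pi * n%:R) = cos y.
  have -> : y + 2 * pi * n%:R = y + (pi *+ 2) *+ n.
    by rewrite -mulrnA -[X in _ = _ + X]mulr_natr natrM; ring.
  by rewrite periodicn //; exact: cosD2pi.
case: k => n; first exact: step.
rewrite NegzE -[LHS](step n.+1); congr cos.
by rewrite rmorphN /=; ring.
Qed.

Lemma sinD2piz x k : sin (x + 2 * pi * k%:~R) = sin x.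
Proof. by rewrite -!cosBpihalf addrAC cosD2piz. Qed.

Lemma cosDcos x y : cos (x + y) + cos (x - y) = 2 * (cos x * cos y).
Proof. by rewrite cosD cosB; ring. Qed.

Lemma sinDsin x y : sin (x + y) - sin (x - y) = 2 * (cos x * sin y).
Proof. by rewrite sinD sinB; ring. Qed.

Lemma sum_cos_telescope x b n :
  2 * sin (b / 2) * \sum_(i < n) cos (x + i%:R * b) =
  sin (x + (n%:R - 1 / 2) * b) - sin (x - b / 2).
Proof.
elim: n => [|n IHn].
  by rewrite big_ord0 (_ : (0%:R - 1/2) * b = - (b / 2)); [ring|rewrite mulr0n; ring].
rewrite big_ord_recr /= mulrDr IHn.
have -> : 2 * sin (b / 2) * cos (x + n%:R * b) =
    sin (x + n%:R * b + b / 2) - sin (x + n%:R * b - b / 2).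
  by rewrite sinDsin; ring.
rewrite -[n.+1%:R]natr1.
rewrite (_ : x + n%:R * b + b / 2 = x + (n%:R + 1 - 1 / 2) * b); last by field.
rewrite (_ : x + n%:R * b - b / 2 = x + (n%:R - 1 / 2) * b); last by field.
ring.
Qed.

Lemma norm_sum_cos_le x b n :
  `|sin (b / 2)| * `|\sum_(i < n) cos (x + i%:R * b)| <= 1.
Proof.
have := ler_normB (sin (x + (n%:R - 1 / 2) * b)) (sin (x - b / 2)).
rewrite -sum_cos_telescope !normrM (ger0_norm (_ : (0 : R) <= 2)) //.
have := sin_max (x + (n%:R - 1 / 2) * b); have := sin_max (x - b / 2).
lra.
Qed.

(* sin (pi k / n) does not vanish, so the telescoped sum is a genuine multiple
   of the cosine sum. *)
Lemma sum_cos_root_unity x n k : k != 0 -> (`|k| < n)%N ->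
  \sum_(i < n) cos (x + i%:R * (2 * pi * k%:~R / n%:R)) = 0.
Proof.
move=> k0 kn; have n0 : (0 : R) < n%:R by rewrite ltr0n (leq_ltn_trans _ kn).
set b := 2 * pi * k%:~R / n%:R.
have := sum_cos_telescope x b n.
rewrite (_ : x + (n%:R - 1 / 2) * b = x - b / 2 + 2 * pi * k%:~R); last first.
  by rewrite /b; field; rewrite gt_eqF.
rewrite sinD2piz subrr => /eqP; rewrite !mulf_eq0 pnatr_eq0 /=.
case/orP => [|/eqP//].
have -> : b / 2 = Num.sg (k%:~R : R) * (pi * (`|k|%N%:R / n%:R)).
  rewrite /b natr_absz intr_norm {1}[k%:~R]numEsg; field.
  by rewrite gt_eqF.
rewrite sin_sg mulf_eq0 sgr_eq0 intr_eq0 (negPf k0) /= gt_eqF // sin_gt0_pi //.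
rewrite mulr_gt0 ?pi_gt0 ?divr_gt0 // ?ltr0n ?absz_gt0 //=.
by rewrite gtr_pMr ?pi_gt0 // ltr_pdivrMr // mul1r ltr_nat.
Qed.

(** By the symmetry y -> 1 - y it is enough that sin (pi y) >= y on [0, 1/2]. *)
Lemma sin_pi_ge y delta : 0 < delta -> delta <= y -> y <= 1 - delta ->
  delta <= sin (pi * y).
Proof.
wlog yle : y / y <= 1 / 2.
  move=> wlg d0 dy yd; have [yh|yh] := lerP y (1 / 2); first exact: wlg.
  rewrite -[pi * y]opprK -(mulN1r (- _)) -[sin _]opprK.
  have -> : sin (- 1 * - (pi * y)) = sin (pi * (1 - y)).
    by rewrite mulN1r opprK mulrBr mulr1 sinB sinpi cospi; ring.
  by rewrite opprK; apply: wlg; lra.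
move=> d0 dy yd; have y0 : 0 < y by lra.
have pi2 := @pi_ge2 R; have cos2 z : cos (2 * z) = 1 - 2 * sin z ^+ 2.
  by rewrite mulr_natl cos_mulr2n cos2sin2; ring.
(* Above 1/4, cos (2 pi y) <= 0 gives sin (pi y) ^ 2 >= 1/2. Below, the mean value theorem applies
   with cos c >= 1/2, which follows from cos (2 c) >= 0, and pi >= 2 concludes. *)
have [y4|y4] := lerP y (1 / 4); last first.
  have : 0 <= cos (pi - 2 * (pi * y)) by apply: cos_ge0_pihalf; nra.
  have : 0 <= sin (pi * y) by apply: sin_ge0_pi; nra.
  by rewrite cosB cospi sinpi cos2; nra.
have [c] : exists2 c, c \in `[0, pi * y] &
    sin (pi * y) - sin 0 = cos c * (pi * y - 0).
  apply: (@MVT_segment R sin cos) ; first by nra.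
  by apply/continuous_subspaceT => x; exact: continuous_sin.
rewrite in_itv /= sin0 !subr0 => /andP[c0 cy] ->.
have : 0 <= cos c by apply: cos_ge0_pihalf; nra.
have : 0 <= cos (2 * c) by apply: cos_ge0_pihalf; nra.
rewrite cos2 sin2cos2 => c1 c2; have c3 : 1 / 2 <= cos c by nra.
have : 2 * y <= pi * y by rewrite ler_wpM2r // ltW.
nra.
Qed.

Section fejer.
Variable K : nat.
Hypothesis K0 : (0 < K)%N.

(** This is K^-1 |sum_(k < K) e^(2 pi i k y)|^2 in real form; the double sum displays the
    frequencies k - l. *)
Definition fejer y : R :=
  K%:R^-1 * \sum_(k < K) \sum_(l < K) cos (2 * pi * (k%:R - l%:R) * y).

(** The sine sum is written as a cosine sum of phase - pi / 2, so that [norm_sum_cos_le] bounds both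
    squares. *)
Lemma fejerE y : fejer y = K%:R^-1 *
  ((\sum_(k < K) cos (0 + k%:R * (2 * pi * y))) ^+ 2 +
   (\sum_(k < K) cos (- (pi / 2) + k%:R * (2 * pi * y))) ^+ 2).
Proof.
rewrite /fejer; congr (_ * _).
rewrite !expr2 !mulr_suml -big_split /=; apply: eq_bigr => k _.
rewrite !mulr_sumr -big_split /=; apply: eq_bigr => l _.
rewrite !add0r ![- (pi / 2) + _]addrC !cosBpihalf -cosB; congr cos; ring.
Qed.

Lemma fejer_ge0 y : 0 <= fejer y.
Proof. by rewrite fejerE mulr_ge0 ?invr_ge0 // addr_ge0 ?sqr_ge0. Qed.

Lemma fejer_le y : fejer y * (K%:R * sin (pi * y) ^+ 2) <= 2.
Proof.
have K0' : (K%:R : R) != 0 by rewrite pnatr_eq0 -lt0n.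
have := norm_sum_cos_le 0 (2 * pi * y) K.
have := norm_sum_cos_le (- (pi / 2)) (2 * pi * y) K.
rewrite -!normrM (_ : 2 * pi * y / 2 = pi * y); last by field.
rewrite -(@ler_sqr _ _ 1) ?nnegrE // expr1n real_normK ?num_real // => h1.
rewrite -(@ler_sqr _ _ 1) ?nnegrE // expr1n real_normK ?num_real // => h2.
rewrite fejerE.
move: h1 h2; set A := \sum_(i < K) _; set B := \sum_(i < K) _ => h1 h2.
rewrite (_ : _ * _ = (sin (pi * y) * A) ^+ 2 + (sin (pi * y) * B) ^+ 2).
  lra.
by field.
Qed.

Lemma fejerDz y k : fejer (y + k%:~R) = fejer y.
Proof.
rewrite /fejer; congr (_ * _); apply: eq_bigr => i _; apply: eq_bigr => j _.
rewrite -[RHS](cosD2piz _ ((i%:Z - j%:Z) * k)); congr cos.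
by rewrite rmorphM rmorphB /=; ring.
Qed.

(** Orthogonality of the K-th roots of unity: the terms with k != l cancel since 0 < |k - l| < K,
    and each of the K diagonal terms gives K. *)
Lemma sum_fejer y m : \sum_(i < K) fejer (y - (m + i%:R) / K%:R) = K%:R.
Proof.
have K0' : (K%:R : R) != 0 by rewrite pnatr_eq0 -lt0n.
rewrite /fejer -mulr_sumr exchange_big /=.
under eq_bigr => k _ do rewrite exchange_big /=.
suff sumkl (k l : 'I_K) :
    \sum_(i < K) cos (2 * pi * (k%:R - l%:R) * (y - (m + i%:R) / K%:R)) =
    if k == l then K%:R else 0 :> R.
  under eq_bigr => k _ do under eq_bigr => l _ do rewrite sumkl eq_sym.
  under eq_bigr => k _ do rewrite -big_mkcond /= big_pred1_eq.
  by rewrite sumr_const card_ord -[in LHS]mulr_natr; field.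
have [->|kl] := eqVneq k l.
  under eq_bigr => i _ do rewrite subrr mulr0 mul0r cos0.
  by rewrite sumr_const card_ord.
rewrite -[RHS](@sum_cos_root_unity
   (2 * pi * (k%:R - l%:R) * (y - m / K%:R)) K (l%:Z - k%:Z)).
- by apply: eq_bigr => i _; congr cos; rewrite rmorphB /=; field.
- by rewrite subr_eq0 eqz_nat eq_sym.
- by have := ltn_ord k; have := ltn_ord l; lia.
Qed.

End fejer.

End cosine_sums.

(** * Majorants of arcs *)

Section majorant.
Variable R : realType.
Implicit Types (y c delta rho s : R) (K : nat) (k : int).

Definition near_int (z rho : R) : Prop := exists k : int, `|z + k%:~R| <= rho.

(** For s >= 0, the [window_size K s] consecutive points of (1/K) Z starting at [window_start K c s]
    / K exhaust those in [c - s, c + s): the first is the least one not below c - s, and the one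
    following the last is at least c + s. *)
Definition window_start K c s : R := (Num.ceil (K%:R * (c - s)))%:~R.

Definition window_size K s : nat := `|Num.ceil (2 * K%:R * s)|%N.

Definition majorant K c s y : R := K%:R^-1 *
  \sum_(i < window_size K s) fejer R K (y - (window_start K c s + i%:R) / K%:R).

Lemma window_sizeE K s : 0 <= s ->
  (window_size K s)%:R = (Num.ceil (2 * K%:R * s))%:~R :> R.
Proof.
move=> s0; rewrite /window_size natr_absz ger0_norm // ceil_ge0.
by rewrite (lt_le_trans (ltrN10 R)) // !mulr_ge0.
Qed.

Lemma window_size_le K s : 0 <= s -> (window_size K s)%:R <= 2 * K%:R * s + 1.
Proof.
move=> s0; rewrite window_sizeE //; have := ceilB1_lt (2 * K%:R * s).
by rewrite rmorphB /=; lra.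
Qed.

Lemma majorant_ge0 K c s y : 0 <= majorant K c s y.
Proof. by rewrite mulr_ge0 ?invr_ge0 // sumr_ge0 // => i _; exact: fejer_ge0. Qed.

Lemma majorantDz K c s y k : majorant K c s (y + k%:~R) = majorant K c s y.
Proof.
by congr (_ * _); apply: eq_bigr => i _; rewrite addrAC fejerDz.
Qed.

(** Over a full period the kernels sum to K. Those left out of the window have centres at distance
    at least delta from y modulo 1, so each is at most 2 / (K delta ^ 2), and there are at most K of
    them. A window longer than a period leaves none out. *)
Lemma majorant_ge K c delta rho y : (0 < K)%N -> 0 < delta -> 0 <= rho ->
  near_int (y - c) (rho + delta) ->
  1 - 2 / (K%:R * delta ^+ 2) <= majorant K c (rho + 2 * delta) y.
Proof.
move=> K0 d0 rho0 [k]; rewrite addrAC -(majorantDz K c _ y k).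
move: (y + k%:~R) => {}y; rewrite ler_norml => /andP[yc1 yc2].
have K0' : 0 < K%:R :> R by rewrite ltr0n.
set s := rho + 2 * delta; have s0 : 0 <= s by rewrite /s; lra.
set m := window_start K c s.
have m1 : K%:R * (c - s) <= m by exact: ceil_ge.
have m2 : m < K%:R * (c - s) + 1.
  by have := ceilB1_lt (K%:R * (c - s)); rewrite rmorphB /= -/m; lra.
have L1 : 2 * K%:R * s <= (window_size K s)%:R by rewrite window_sizeE // ceil_ge.
set f := fun i : nat => fejer R K (y - (m + i%:R) / K%:R).
have f0 i : 0 <= f i by exact: fejer_ge0.
have fE : \sum_(0 <= i < K) f i = K%:R.
  by rewrite big_mkord /f sum_fejer.
(* The centre of index i lies to the right of y, by at least delta because the window has ended, and
   by at most 1 - delta because a period after its start has not elapsed. *)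
have fL i : (window_size K s <= i < K)%N -> f i <= 2 / (K%:R * delta ^+ 2).
  move=> /andP[Li iK].
  have Li' : (window_size K s)%:R <= i%:R :> R by rewrite ler_nat.
  have iK' : i%:R + 1 <= K%:R :> R by rewrite natr1 ler_nat.
  set d := (m + i%:R) / K%:R - y.
  have dE : K%:R * d = m + i%:R - K%:R * y by rewrite /d; field; rewrite gt_eqF.
  have d1 : delta <= d by rewrite -(ler_pM2l K0') dE; rewrite /s in m1 L1; nra.
  have d2 : d <= 1 - delta by rewrite -(ler_pM2l K0') dE; rewrite /s in m2; nra.
  have sd := sin_pi_ge _ _ _ d0 d1 d2.
  have := fejer_le R K K0 (y - (m + i%:R) / K%:R).
  rewrite -/(f i) -opprB -/d mulrN sinN sqrrN => h.
  rewrite ler_pdivlMr ?mulr_gt0 ?exprn_gt0 //; apply: le_trans h.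
  by rewrite ler_wpM2l // ler_wpM2l // ler_sqr ?nnegrE; lra.
have e0 : 0 <= 2 / (K%:R * delta ^+ 2).
  by rewrite divr_ge0 // mulr_ge0 ?sqr_ge0.
move: (2 / _) e0 fL => e e0 fL.
set L := window_size K s in fL L1 *.
rewrite /majorant -/m -/L -[X in _ <= _ * X](big_mkord xpredT f) /=.
have : K%:R - K%:R * e <= \sum_(0 <= i < L) f i.
  rewrite lerBlDr -[X in X <= _]fE.
  have [LK|KL] := leqP L K.
    rewrite (big_cat_nat _ (n := L)) //= lerD2l.
    rewrite (@le_trans _ _ (\sum_(L <= i < K) e)) //.
      by rewrite big_nat [leRHS]big_nat ler_sum.
    by rewrite sumr_const_nat -[leLHS]mulr_natl ler_wpM2r // ler_nat leq_subr.
  rewrite [X in _ <= X + _](big_cat_nat _ (n := K)) //= 1?ltnW // -addrA.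
  by rewrite lerDl addr_ge0 ?mulr_ge0 ?sumr_ge0.
by rewrite [_ * \sum_(_ <= _ < _) _]mulrC ler_pdivlMr //; lra.
Qed.

(** The diagonal of each Fejer kernel contributes exactly the mean; only nonzero frequencies
    remain. *)
Lemma majorantB K c s y : (0 < K)%N ->
  majorant K c s y - (window_size K s)%:R / K%:R =
  K%:R^-1 ^+ 2 * \sum_(p : 'I_K * 'I_K | p.1 != p.2)
    \sum_(i < window_size K s) cos (2 * pi * (p.1%:R - p.2%:R) *
       (y - (window_start K c s + i%:R) / K%:R)).
Proof.
move=> K0; have K0' : K%:R != 0 :> R by rewrite pnatr_eq0 -lt0n.
rewrite exchange_big /majorant expr2 -mulrA [X in _ = _ * X]mulr_sumr.
have -> : (window_size K s)%:R / K%:R =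
  K%:R^-1 * \sum_(i < window_size K s) (1 : R).
  by rewrite sumr_const card_ord mulrC.
rewrite -mulrBr -sumrB; congr (_ * _); apply: eq_bigr => i _.
rewrite /fejer pair_big /= (bigID (fun p : 'I_K * 'I_K => p.1 == p.2)) /=.
rewrite mulrDr addrAC -[RHS]add0r; congr (_ + _).
rewrite (eq_bigr (fun=> 1)) => [|p /eqP ->]; last by rewrite subrr mulr0 mul0r cos0.
rewrite -(pair_big_dep xpredT (fun k l : 'I_K => k == l) (fun _ _ => 1 : R)) /=.
under eq_bigr => k _ do under eq_bigl => l do rewrite eq_sym.
under eq_bigr => k _ do rewrite big_pred1_eq.
by rewrite sumr_const card_ord mulVf // subrr.
Qed.

End majorant.

(** * Riesz products over the Cantor set *)

Section riesz.
Variable R : realType.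
Implicit Types (x t phi : R) (m n M : nat).

Fixpoint cantor_left M : seq R :=
  if M is M'.+1 then [seq c / 3 | c <- cantor_left M'] ++
                     [seq (c + 2) / 3 | c <- cantor_left M']
  else [:: 0].

Lemma cantor_left_cover M a :
  iter M (@cantor_step R) `[0, 1]%classic a ->
  exists2 c, c \in cantor_left M & c <= a <= c + 3^-1 ^+ M.
Proof.
elim: M a => [|M IHM] a /=.
  by rewrite in_itv /= => ?; exists 0; rewrite ?inE // expr0 add0r.
case=> -[b /IHM[c cM /andP[cb bc]] <-]; rewrite exprS.
  exists (c / 3); first by rewrite mem_cat (map_f (fun x => x / 3)).
  by apply/andP; split; lra.
exists ((c + 2) / 3); last by apply/andP; split; lra.
by rewrite mem_cat (map_f (fun x => (x + 2) / 3)) ?orbT.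
Qed.

(** Modulus of the Fourier transform at t of the uniform probability measure on [cantor_left m]. *)
Definition riesz m t : R := \prod_(j < m) `|cos (2 * pi * t / 3 ^+ j.+1)|.

Lemma riesz_ge0 m t : 0 <= riesz m t.
Proof. by rewrite prodr_ge0. Qed.

Lemma rieszSr m t : riesz m.+1 t = riesz m t * `|cos (2 * pi * t / 3 ^+ m.+1)|.
Proof. by rewrite /riesz big_ord_recr. Qed.

Lemma rieszSl m t : riesz m.+1 t = `|cos (2 * pi * t / 3)| * riesz m (t / 3).
Proof.
rewrite /riesz big_ord_recl expr1; congr (_ * _).
apply: eq_bigr => j _; congr (`|cos _|); rewrite /= exprS; field.
by rewrite expf_neq0.
Qed.

Lemma riesz_le m M t : (m <= M)%N -> riesz M t <= riesz m t.
Proof.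
move=> /subnK <-; elim: (M - m)%N => // n IHn; apply: le_trans IHn.
by rewrite addSn rieszSr ler_piMr ?riesz_ge0 ?cos_max.
Qed.

Lemma riesz_le1 m t : riesz m t <= 1.
Proof. by apply: le_trans (riesz_le _ _ t (leq0n m)) _; rewrite /riesz big_ord0. Qed.

Lemma rieszN m t : riesz m (- t) = riesz m t.
Proof.
by apply: eq_bigr => j _; rewrite mulrN mulNr cosN.
Qed.

(** The first v factors are cosines of integer multiples of 2 pi, hence equal to 1. *)
Lemma riesz_mul3X v m n : riesz (v + m) (3 ^+ v * n%:R) = riesz m n%:R.
Proof.
elim: v => [|v IHv]; first by rewrite mul1r.
rewrite addSn rieszSl exprS (_ : 3 * _ * _ / 3 = 3 ^+ v * n%:R); last by field.
rewrite IHv (_ : 2 * pi * _ / 3 = 0 + 2 * pi * (3 ^ v * n)%N%:~R).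
  by rewrite cosD2piz cos0 normr1 mul1r.
by rewrite -pmulrn natrM natrX; field.
Qed.

Lemma rieszD3X m t n : riesz m (t + n%:R * 3 ^+ m) = riesz m t.
Proof.
apply: eq_bigr => j _; congr (`|_|); have jm := ltn_ord j.
rewrite -[RHS](cosD2piz R _ (n * 3 ^ (m - j.+1))%N); congr cos.
have -> : (3 : R) ^+ m = 3 ^+ j.+1 * 3 ^+ (m - j.+1) by rewrite -exprD subnKC.
rewrite -pmulrn natrM natrX; field.
by rewrite expf_neq0.
Qed.

Lemma riesz_modn m n : riesz m (n %% 3 ^ m)%N%:R = riesz m n%:R.
Proof.
rewrite [in RHS](divn_eq n (3 ^ m)) natrD natrM natrX addrC.
by rewrite rieszD3X.
Qed.

(** The two halves of the Cantor set pair up by the sum-to-product formula, which extracts 2 cos (2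
    pi t / 3) and shifts the phase; the arbitrary phi makes the induction go through. *)
Lemma norm_sum_cantor_cos M t phi :
  `|\sum_(c <- cantor_left M) cos (2 * pi * t * c + phi)| <= 2 ^+ M * riesz M t.
Proof.
elim: M t phi => [|M IHM] t phi /=.
  by rewrite big_seq1 /riesz big_ord0 mul1r cos_max.
rewrite big_cat /= !big_map -big_split /=.
have -> : \sum_(c <- cantor_left M) (cos (2 * pi * t * (c / 3) + phi) +
      cos (2 * pi * t * ((c + 2) / 3) + phi)) =
    2 * cos (2 * pi * t / 3) * \sum_(c <- cantor_left M)
      cos (2 * pi * (t / 3) * c + (phi + 2 * pi * t / 3)).
  rewrite mulr_sumr; apply: eq_bigr => c _.
  rewrite -[RHS]mulrA [X in _ = _ * X]mulrC -cosDcos addrC.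
  by congr (cos _ + cos _); field.
rewrite rieszSl !normrM ger0_norm // exprS.
rewrite -[leRHS]mulrA -[leLHS]mulrA ler_wpM2l // [leRHS]mulrCA ler_wpM2l //.
Qed.

Lemma sum_cos2_third x :
  \sum_(i < 3) cos (x + 2 * pi * i%:R / 3) ^+ 2 = 3 / 2.
Proof.
have cos2 z : cos z ^+ 2 = 1 / 2 + cos (2 * z) / 2.
  by rewrite mulr_natl cos_mulr2n; field.
rewrite (eq_bigr (fun i : 'I_3 => 1 / 2 +
    cos (2 * x + i%:R * (2 * pi * 2%:~R / 3%:R)) / 2)) => [|i _].
  rewrite big_split /= -[X in _ + X]mulr_suml sum_cos_root_unity // mul0r addr0.
  by rewrite sumr_const card_ord -[LHS]mulr_natr; field.
by rewrite cos2; congr (_ + cos _ / _); rewrite -pmulrn; field.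
Qed.

(** Write a residue modulo 3 ^ m.+1 as s + i 3 ^ m with i < 3. The first m factors depend on s only,
    and the squares of the last one sum to 3/2 over i. *)
Lemma sum_riesz m : \sum_(0 <= t < 3 ^ m) riesz m t%:R ^+ 2 = (3 / 2) ^+ m.
Proof.
elim: m => [|m IHm].
  by rewrite big_nat1 /riesz big_ord0 expr1n.
rewrite expnS big_nat_mul.
have -> : \sum_(0 <= i < 3) \sum_(i * 3 ^ m <= j < i.+1 * 3 ^ m)
    riesz m.+1 j%:R ^+ 2 = \sum_(0 <= i < 3) \sum_(0 <= s < 3 ^ m)
    riesz m s%:R ^+ 2 * cos (2 * pi * s%:R / 3 ^+ m.+1 + 2 * pi * i%:R / 3) ^+ 2.
  apply: eq_bigr => i _; rewrite -[X in \sum_(X <= _ < _) _]add0n big_addn.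
  rewrite mulSn addnK; apply: eq_bigr => s _.
  rewrite rieszSr exprMn real_normK ?num_real // natrD natrM natrX rieszD3X.
  congr (_ * cos _ ^+ 2); rewrite exprS; field.
  by rewrite expf_neq0.
rewrite exchange_big /= [RHS]exprS -IHm [RHS]mulrC mulr_suml; apply: eq_bigr => s _.
by rewrite -mulr_sumr big_mkord sum_cos2_third.
Qed.

End riesz.

(** * Powers of 2 modulo powers of 3 *)

Lemma exp4_pow3 m : exists u, (4 ^ (3 ^ m) = 1 + 3 ^ m.+1 * u)%N /\ ~~ (3 %| u)%N.
Proof.
elim: m => [|m [u [e u3]]]; first by exists 1%N.
(* Cube 1 + 3 ^ m.+1 u and take out 3 ^ m.+2; the cofactor of u is 1 modulo 3. *)
exists (u * (1 + 3 ^ m.+1 * u + 3 ^ m * 3 ^ m.+1 * u ^ 2))%N; split.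
  by rewrite expnSr expnM e !expnS; ring.
rewrite Euclid_dvdM // negb_or u3 /= !expnS.
rewrite -addnA dvdn_addl //; apply/dvdnP.
by exists (3 ^ m * u + 3 ^ m * 3 ^ m * u ^ 2)%N; ring.
Qed.

(** The order of 4 modulo 3 ^ m.+1 is a multiple of 3 ^ m. In the inductive step e = f 3 ^ m, and
    the binomial expansion to first order gives 4 ^ e = 1 + 3 ^ m.+1 u f modulo 3 ^ m.+2 with u
    prime to 3, so 3 divides f. *)
Lemma dvdn_exp4B1 m e : (3 ^ m.+1 %| 4 ^ e - 1)%N -> (3 ^ m %| e)%N.
Proof.
elim: m => [|m IHm]; first by rewrite dvd1n.
move=> h; have /IHm/dvdnP[f ef] : (3 ^ m.+1 %| 4 ^ e - 1)%N.
  by apply: dvdn_trans h; rewrite dvdn_exp2l.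
have [u [eu u3]] := exp4_pow3 m.
have [w ew] : exists w, (4 ^ e = 1 + 3 ^ m.+1 * (u * f) + 3 ^ m.+2 * w)%N.
  rewrite {h IHm}ef mulnC expnM eu; elim: f => [|f [w IHf]].
    by exists 0%N; rewrite !muln0 addn0.
  exists (w + 3 ^ m * u * (u * f) + 3 ^ m.+1 * u * w)%N.
  by rewrite expnS IHf !expnS; ring.
move: h; rewrite ew -addnA add1n subn1 /= dvdn_addl; last exact: dvdn_mulr.
rewrite (expnSr 3 m.+1) dvdn_pmul2l ?expn_gt0 //.
by rewrite Euclid_dvdM // (negPf u3) /= ef expnS => f3; rewrite dvdn_mul.
Qed.

(** With d = j - i, cancelling k 2 ^ i leaves 2 ^ d = 1. Modulo 3 this forces d = 2 e, so 4 ^ e = 1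
    and 3 ^ m divides e, while e <= d < 3 ^ m. *)
Lemma mul_exp2_modn_inj m k i j : coprime 3 k -> (i <= j < i + 3 ^ m)%N ->
  (k * 2 ^ i = k * 2 ^ j %[mod 3 ^ m.+1])%N -> i = j.
Proof.
move=> k3 /andP[ij]; rewrite -(subnKC ij); move: (j - i)%N => d {j ij}.
rewrite ltn_add2l => dm /esym/eqP; rewrite expnD mulnA eqn_mod_dvd; last first.
  by rewrite leq_pmulr // expn_gt0.
rewrite -[X in (_ - X)%N]muln1 -mulnBr Gauss_dvdr; last first.
  by rewrite coprimeXl // coprimeMr k3 coprimeXr.
move=> h; suff -> : d = 0%N by rewrite addn0.
have [e de] : exists e, d = (2 * e)%N.
  exists d./2; rewrite mul2n; apply/esym; rewrite -[RHS]odd_double_half.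
  case: (boolP (odd d)) => // dodd.
  have : (3 %| 2 ^ d - 1)%N by apply: dvdn_trans h; rewrite expnS dvdn_mulr.
  rewrite -(odd_double_half d) dodd expnS -mul2n expnM -eqn_mod_dvd; last first.
    by rewrite muln_gt0 expn_gt0.
  by rewrite -modnMmr -modnXm exp1n.
move: h; rewrite de expnM => /dvdn_exp4B1 h.
have [->|e0] := posnP e; first by [].
by have := dvdn_leq e0 h; lia.
Qed.

(** * Averages of Riesz products along k 2 ^ n *)

Section weyl.
Variable R : realType.
Implicit Types (m k M N : nat).

Lemma sqr_sum_le (I : Type) (r : seq I) (P : pred I) (f : I -> R) :
  (\sum_(i <- r | P i) f i) ^+ 2 <=
  (\sum_(i <- r | P i) 1) * \sum_(i <- r | P i) f i ^+ 2.
Proof.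
have sqE : (\sum_(i <- r | P i) f i) ^+ 2 =
    \sum_(i <- r | P i) \sum_(j <- r | P j) f i * f j.
  by rewrite expr2 mulr_suml; apply: eq_bigr => i _; rewrite mulr_sumr.
have oneE : (\sum_(i <- r | P i) 1) * \sum_(i <- r | P i) f i ^+ 2 =
    \sum_(i <- r | P i) \sum_(j <- r | P j) f j ^+ 2.
  by rewrite mulr_suml; apply: eq_bigr => i _; rewrite mul1r.
have oneE' : (\sum_(i <- r | P i) 1) * \sum_(i <- r | P i) f i ^+ 2 =
    \sum_(i <- r | P i) \sum_(j <- r | P j) f i ^+ 2.
  by rewrite oneE exchange_big.
have : 2 * (\sum_(i <- r | P i) f i) ^+ 2 <=
    2 * ((\sum_(i <- r | P i) 1) * \sum_(i <- r | P i) f i ^+ 2).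
  rewrite [leRHS]mulr_natl mulr2n [X in _ <= X + _]oneE [X in _ <= _ + X]oneE'.
  rewrite -big_split /= sqE mulr_sumr.
  apply: ler_sum => i _; rewrite -big_split /= mulr_sumr; apply: ler_sum => j _.
  by have := sqr_ge0 (f i - f j); nra.
by rewrite ler_pM2l.
Qed.

Lemma ler_sum_inj (I J : finType) (h : I -> J) (F : J -> R) :
  injective h -> (forall j, 0 <= F j) -> \sum_i F (h i) <= \sum_j F j.
Proof.
move=> hinj F0; rewrite -(big_imset F (in2W hinj)) /=.
rewrite [leRHS](bigID (mem [set h x | x in I]%SET)) /= lerDl.
by rewrite sumr_ge0.
Qed.

(** [riesz] of length m.+1 depends only on the residue modulo 3 ^ m.+1, and the residues of k 2 ^ n
    in the block are distinct, so the sum is part of the one in [sum_riesz]. *)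
Lemma sum_riesz_block m k b : coprime 3 k ->
  \sum_(b * 3 ^ m <= n < b.+1 * 3 ^ m) riesz R m.+1 (k * 2 ^ n)%N%:R ^+ 2
    <= (3 / 2) ^+ m.+1.
Proof.
move=> k3; rewrite -[X in \sum_(X <= _ < _) _]add0n big_addn mulSn addnK.
rewrite -sum_riesz !big_mkord.
have p3 : (0 < 3 ^ m.+1)%N by rewrite expn_gt0.
pose h (i : 'I_(3 ^ m)) : 'I_(3 ^ m.+1) :=
  Ordinal (ltn_pmod (k * 2 ^ (i + b * 3 ^ m)) p3).
have hinj : injective h.
  move=> i j /(congr1 val) /= e; apply/val_inj => /=.
  apply: (@addIn (b * 3 ^ m)%N); have := ltn_ord i; have := ltn_ord j.
  by case/orP: (leq_total i j) => ij jm im; [|symmetry];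
    apply: (mul_exp2_modn_inj m k) => //; lia.
under eq_bigr => i _ do rewrite -riesz_modn.
apply: (ler_sum_inj _ _ h (fun t : 'I__ => riesz R m.+1 t%:R ^+ 2) hinj) => t.
exact: sqr_ge0.
Qed.

(* Cauchy-Schwarz; the range is covered by nine blocks of length 3 ^ m, on each of
   which k 2 ^ n is injective modulo 3 ^ (m+1). *)
Lemma sum_riesz_coprime m N k : coprime 3 k -> (3 ^ m.+1 <= N < 3 ^ m.+2)%N ->
  (\sum_(0 <= n < N) riesz R m.+1 (k * 2 ^ n)%N%:R) ^+ 2 * 2 ^+ m.+1
    <= 9 * N%:R ^+ 2.
Proof.
move=> k3 /andP[mN Nm].
have : \sum_(0 <= n < N) riesz R m.+1 (k * 2 ^ n)%N%:R ^+ 2 <= 9 * (3 / 2) ^+ m.+1.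
  apply: (@le_trans _ _ (\sum_(0 <= n < 9 * 3 ^ m)
      riesz R m.+1 (k * 2 ^ n)%N%:R ^+ 2)).
    rewrite (big_cat_nat _ (n := N) (p := 9 * 3 ^ m)) //=.
      by rewrite lerDl sumr_ge0 // => i _; rewrite sqr_ge0.
    by move: Nm; rewrite !expnS; lia.
  rewrite big_nat_mul (@le_trans _ _ (\sum_(0 <= b < 9) (3 / 2) ^+ m.+1)) //.
    by apply: ler_sum => b _; exact: sum_riesz_block.
  by rewrite sumr_const_nat subn0 -[leLHS]mulr_natl.
have := sqr_sum_le _ (index_iota 0 N) xpredT
  (fun n => riesz R m.+1 (k * 2 ^ n)%N%:R).
rewrite sumr_const_nat subn0 => h1 h2.
have h3 := le_trans h1 (ler_wpM2l (ler0n R N) h2).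
have p2 : 0 <= (2 : R) ^+ m.+1 by rewrite exprn_ge0.
apply: le_trans (ler_wpM2r p2 h3) _.
have -> : N%:R * (9 * (3 / 2) ^+ m.+1) * 2 ^+ m.+1 = N%:R * 9 * 3 ^+ m.+1 :> R.
  by rewrite -!mulrA -exprMn; congr (_ * (_ * _ ^+ _)); field.
rewrite expr2 mulrA [9 * _]mulrC ler_wpM2l ?mulr_ge0 //.
by rewrite -natrX ler_nat.
Qed.

(** A factor 3 ^ v of k uses up v factors of the product. As v <= k, the assumption on M leaves at
    least m.+1 of them for the part of k prime to 3. *)
Lemma sum_riesz_exp2 m N k M : (0 < k)%N -> (3 ^ m.+1 <= N < 3 ^ m.+2)%N ->
  (k + m.+1 <= M)%N ->
  (\sum_(0 <= n < N) riesz R M (k * 2 ^ n)%N%:R) ^+ 2 * 2 ^+ m.+1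
    <= 9 * N%:R ^+ 2.
Proof.
move=> k0 mN kM; have [k' k'3 ek] := pfactor_coprime (isT : prime 3) k0.
apply: le_trans (sum_riesz_coprime _ _ _ k'3 mN).
rewrite ler_wpM2r ?exprn_ge0 // ler_sqr ?nnegrE ?sumr_ge0 //; last 2 first.
- by move=> i _; exact: riesz_ge0.
- by move=> i _; exact: riesz_ge0.
apply: ler_sum => n _; rewrite -[leRHS](riesz_mul3X R (logn 3 k)) {1}ek.
have -> : 3 ^+ logn 3 k * (k' * 2 ^ n)%N%:R = (k' * 3 ^ logn 3 k * 2 ^ n)%N%:R :> R.
  by rewrite -natrX -natrM; congr (_%:R); ring.
apply: riesz_le; apply: leq_trans kM; rewrite leq_add2r.
apply: ltnW; apply: leq_trans (ltn_expl (logn 3 k) (isT : (1 < 3)%N)) _.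
exact: dvdn_leq (pfactor_dvdnn 3 k).
Qed.

(* N = j ^ 40 and 3 ^ m <= N < 3 ^ (m + 1) give 2 ^ (m + 1) >= j ^ 20. *)
Lemma sum_riesz_pow j k M : (1 < j)%N -> (0 < k)%N -> (k + j ^ 40 <= M)%N ->
  (\sum_(0 <= n < j ^ 40) riesz R M (k * 2 ^ n)%N%:R) * j%:R ^+ 10
    <= 5 * (j ^ 40)%:R.
Proof.
move=> j1 k0 kM; set N := (j ^ 40)%N.
have [m mN] : exists m, (3 ^ m.+1 <= N < 3 ^ m.+2)%N.
  have N3 : (3 <= N)%N.
    by apply: leq_trans (leq_pexp2l (ltnW j1) (isT : (2 <= 40)%N)); nia.
  have l0 : (0 < trunc_log 3 N)%N by rewrite trunc_log_gt0.
  exists (trunc_log 3 N).-1; rewrite prednK //.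
  by apply: trunc_log_bounds => //; lia.
have mM : (k + m.+1 <= M)%N.
  apply: leq_trans kM; rewrite leq_add2l; case/andP: mN => mN _.
  by apply: leq_trans (ltnW (ltn_expl _ _)) mN.
have := sum_riesz_exp2 m N k M k0 mN mM.
set S := \sum_(_ <= _ < _) _ => hS.
have S0 : 0 <= S by rewrite sumr_ge0 // => i _; exact: riesz_ge0.
have j20 : (j%:R ^+ 10) ^+ 2 <= 2 ^+ m.+2 :> R.
  rewrite -exprM -!natrX ler_nat -(leq_exp2r _ _ (isT : (0 < 2)%N)).
  rewrite -!expnM [(m.+2 * 2)%N]mulnC [(2 ^ _)%N]expnM.
  by case/andP: mN => _ /ltnW Nm; apply: leq_trans Nm _; rewrite leq_exp2r.
rewrite -ler_sqr ?nnegrE ?mulr_ge0 ?exprn_ge0 // exprMn.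
apply: (@le_trans _ _ (S ^+ 2 * 2 ^+ m.+2)); first by rewrite ler_wpM2l ?sqr_ge0.
(* The constant 5 comes from 2 * 9 <= 5 ^ 2. *)
rewrite [2 ^+ m.+2]exprS mulrCA exprMn; have := sqr_ge0 (N%:R : R); lra.
Qed.

End weyl.

(** * Variance of the discrepancy *)

Section variance.
Variable R : realType.
Implicit Types (K M N j : nat) (c s : nat -> R).

(** Each closed triangle is summed along its diagonals d = n' - n; letting n + d exceed N only adds
    nonnegative terms. *)
Lemma sum_square_sym N (f : nat -> nat -> R) :
  (forall n n', 0 <= f n n') -> (forall n n', f n n' = f n' n) ->
  \sum_(0 <= n < N) \sum_(0 <= n' < N) f n n' <=
  2 * \sum_(0 <= d < N) \sum_(0 <= n < N) f n (n + d)%N.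
Proof.
move=> f0 fC; rewrite [leRHS]mulr_natl mulr2n.
have upper : \sum_(0 <= n < N) \sum_(n <= n' < N) f n n' <=
    \sum_(0 <= d < N) \sum_(0 <= n < N) f n (n + d)%N.
  rewrite [leRHS]exchange_big /= big_nat [leRHS]big_nat.
  apply: ler_sum => n /andP[_ nN].
  rewrite -[X in \sum_(X <= _ < _) _]add0n big_addn.
  rewrite [leRHS](big_cat_nat _ (n := N - n)) ?leq_subr //=.
  rewrite (eq_bigr (fun i => f n (n + i)%N)) => [|i _]; last by rewrite addnC.
  by rewrite lerDl sumr_ge0.
apply: le_trans (lerD upper upper).
have -> : \sum_(0 <= n < N) \sum_(0 <= n' < N) f n n' =
    \sum_(0 <= n < N) \sum_(0 <= n' < n) f n n' +
    \sum_(0 <= n < N) \sum_(n <= n' < N) f n n'.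
  rewrite -big_split /= [LHS]big_nat [RHS]big_nat; apply: eq_bigr => n /andP[_ nN].
  by rewrite (big_cat_nat _ (n := n)) // ltnW.
rewrite lerD2r.
have -> : \sum_(0 <= n < N) \sum_(0 <= n' < n) f n n' =
    \sum_(0 <= n < N) \sum_(0 <= n' < N) if (n' < n)%N then f n n' else 0.
  rewrite big_nat [RHS]big_nat; apply: eq_bigr => n /andP[_ nN].
  by rewrite (big_nat_widen _ _ N) 1?ltnW // big_mkcond.
rewrite exchange_big /= big_nat [leRHS]big_nat.
apply: ler_sum => n /andP[_ nN].
rewrite [leRHS](big_nat_widenl n 0) // [leRHS]big_mkcond /=.
apply: ler_sum => n' _; rewrite fC.
by have [/ltnW ->|nn'] := ltnP n n'; last case: ifP.
Qed.

Lemma riesz_norm M (t : R) : riesz R M `|t| = riesz R M t.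
Proof. by have [//|_] := ger0P t; rewrite rieszN. Qed.

(** For a gap d > 0 the frequency is, up to sign, k 2 ^ n with k = |h| (2 ^ d - 1), and
    [sum_riesz_pow] applies; M is large enough since k <= j ^ 3 * 2 ^ (j ^ 40). The gap d = 0 is
    bounded trivially, using j ^ 10 <= j ^ 40. Hence 12 = 2 (5 + 1). *)
Lemma sum_riesz_diff j M (h : int) : (1 < j)%N -> h != 0 -> (`|h| < j ^ 3)%N ->
  (j ^ 3 * 2 ^ (j ^ 40) + j ^ 40 <= M)%N ->
  (\sum_(0 <= n < j ^ 40) \sum_(0 <= n' < j ^ 40)
      riesz R M (h%:~R * (2 ^+ n - 2 ^+ n'))) * j%:R ^+ 10
    <= 12 * (j ^ 40)%:R ^+ 2.
Proof.
move=> j1 h0 hj; have j0 : 0 <= (j%:R : R) ^+ 10 by rewrite exprn_ge0.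
have N1 : (0 < j ^ 40)%N by rewrite expn_gt0 ltnW.
have jN : (j%:R : R) ^+ 10 <= (j ^ 40)%:R by rewrite -natrX ler_nat leq_exp2l.
have pow k := @sum_riesz_pow R j k M j1.
move: (j ^ 40)%N (j ^ 3)%N hj N1 jN pow => N K hK N0 jN pow jM.
have N1 : 1 <= (N%:R : R) by rewrite ler1n.
have f0 n n' : 0 <= riesz R M (h%:~R * (2 ^+ n - 2 ^+ n')) by exact: riesz_ge0.
have fC n n' : riesz R M (h%:~R * (2 ^+ n - 2 ^+ n')) =
    riesz R M (h%:~R * (2 ^+ n' - 2 ^+ n)).
  by rewrite -rieszN; congr riesz; ring.
apply: le_trans (ler_wpM2r j0 (sum_square_sym N _ f0 fC)) _.
suff : (\sum_(0 <= d < N) \sum_(0 <= n < N)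
    riesz R M (h%:~R * (2 ^+ n - 2 ^+ (n + d)))) * j%:R ^+ 10 <= 6 * N%:R ^+ 2.
  by lra.
have term d : (0 < d < N)%N ->
    (\sum_(0 <= n < N) riesz R M (h%:~R * (2 ^+ n - 2 ^+ (n + d)))) * j%:R ^+ 10
      <= 5 * N%:R.
  move=> /andP[d0 dN].
  have d2 : (1 < 2 ^ d)%N by rewrite -[1%N](expn0 2) ltn_exp2l.
  rewrite (eq_bigr (fun n => riesz R M (`|h| * (2 ^ d - 1) * 2 ^ n)%N%:R)) => [|n _].
    apply: pow; first by rewrite muln_gt0 absz_gt0 h0 subn_gt0.
    apply: leq_trans jM; rewrite leq_add2r; apply: leq_mul (ltnW hK) _.
    by apply: leq_trans (leq_subr _ _) _; rewrite leq_exp2l // ltnW.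
  rewrite -riesz_norm normrM -intr_norm -natr_absz exprD !natrM natrB 1?ltnW //.
  rewrite !natrX -mulrA; congr (riesz _ _ (_ * _)).
  rewrite (_ : 2 ^+ n - 2 ^+ n * 2 ^+ d = - ((2 ^+ d - 1) * 2 ^+ n) :> R); last by ring.
  by rewrite normrN ger0_norm // mulr_ge0 ?exprn_ge0 // subr_ge0 exprn_ege1 // ler1n.
rewrite mulr_suml.
rewrite (big_cat_nat _ (n := 1%N)) //= big_nat1.
have le1 : \sum_(1 <= d < N) (\sum_(0 <= n < N)
     riesz R M (h%:~R * (2 ^+ n - 2 ^+ (n + d)))) * j%:R ^+ 10 <= 5 * N%:R ^+ 2.
  apply: (@le_trans _ _ (\sum_(1 <= d < N) 5 * N%:R)).
    by rewrite big_nat [leRHS]big_nat; exact: ler_sum.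
  rewrite sumr_const_nat -[leLHS]mulr_natl expr2 mulrCA ler_wpM2l //.
  by rewrite ler_wpM2r // ler_nat leq_subr.
have le0 : (\sum_(0 <= n < N) riesz R M (h%:~R * (2 ^+ n - 2 ^+ (n + 0)))) *
     j%:R ^+ 10 <= N%:R ^+ 2.
  rewrite expr2 ler_pM ?sumr_ge0 //.
  apply: (@le_trans _ _ (\sum_(0 <= n < N) 1)).
    by apply: ler_sum => n _; exact: riesz_le1.
  by rewrite sumr_const_nat subn0.
lra.
Qed.

Lemma second_moment_cos (I : finType) (alpha phi : I -> R) M :
  \sum_(c <- cantor_left R M)
     (\sum_x cos (2 * pi * alpha x * c + phi x)) ^+ 2 <=
  2 ^+ M * \sum_x \sum_x' riesz R M (alpha x - alpha x').
Proof.
apply: (@le_trans _ _ (\sum_(c <- cantor_left R M) \sum_x \sum_x'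
    cos (2 * pi * (alpha x - alpha x') * c + (phi x - phi x')))).
  (* Adding the square of the sine sum gives the squared modulus of an exponential sum, which
     involves only the differences alpha x - alpha x'. *)
  apply: ler_sum => c _.
  have -> : \sum_x \sum_x'
      cos (2 * pi * (alpha x - alpha x') * c + (phi x - phi x')) =
      (\sum_x cos (2 * pi * alpha x * c + phi x)) ^+ 2 +
      (\sum_x sin (2 * pi * alpha x * c + phi x)) ^+ 2.
    rewrite !expr2 !mulr_suml -big_split /=; apply: eq_bigr => x _.
    rewrite !mulr_sumr -big_split /=; apply: eq_bigr => x' _.
    by rewrite -cosB; congr cos; ring.
  by rewrite lerDl sqr_ge0.
rewrite exchange_big mulr_sumr; apply: ler_sum => x _.
rewrite exchange_big mulr_sumr; apply: ler_sum => x' _.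
exact: le_trans (ler_norm _) (norm_sum_cantor_cos _ _ _ _).
Qed.

Definition discrepancy K c s N (a : R) : R := \sum_(n < N)
  (majorant R K (c n) (s n) (2 ^+ n * a) - (window_size R K (s n))%:R / K%:R).

(** The discrepancy is K^-2 times a sum over fewer than K ^ 2 pairs of distinct indices, handled by
    Cauchy-Schwarz. For each pair the second moment involves each time n at most 6 K times, once per
    window point, so the constant is 6 ^ 2 * 12 = 432. *)
Lemma discrepancy_variance j M c s : (1 < j)%N ->
  (forall n, (window_size R (j ^ 3) (s n) <= 6 * j ^ 3)%N) ->
  (j ^ 3 * 2 ^ (j ^ 40) + j ^ 40 <= M)%N ->
  (\sum_(a <- cantor_left R M) discrepancy (j ^ 3) c s (j ^ 40) a ^+ 2)
     * j%:R ^+ 10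
    <= 432 * 2 ^+ M * (j ^ 3)%:R ^+ 2 * (j ^ 40)%:R ^+ 2.
Proof.
move=> j1 sK jM.
have K0 : (0 < j ^ 3)%N by rewrite expn_gt0 ltnW.
have diff (h : int) h0 hK := @sum_riesz_diff j M h j1 h0 hK jM.
move: (j ^ 40)%N (j ^ 3)%N sK K0 diff {jM} => N K sK K0 diff.
have j0 : 0 <= (j%:R : R) ^+ 10 by rewrite exprn_ge0.
have K0' : 0 < (K%:R : R) by rewrite ltr0n.
pose L n := window_size R K (s n).
(* Here x is a time together with a point of the window at that time; the window size varies with
   the time, hence the sigma type. *)
pose W (p : 'I_K * 'I_K) a : R := \sum_(x : {n : 'I_N & 'I_(L n)})
  cos (2 * pi * ((p.1%:R - p.2%:R) * 2 ^+ tag x) * a +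
    - (2 * pi * (p.1%:R - p.2%:R) *
        ((window_start R K (c (tag x)) (s (tag x)) + (tagged x)%:R) / K%:R))).
have discE a : discrepancy K c s N a =
    K%:R^-1 ^+ 2 * \sum_(p : 'I_K * 'I_K | p.1 != p.2) W p a.
  rewrite /discrepancy.
  under eq_bigr => n _ do rewrite majorantB //.
  rewrite -mulr_sumr exchange_big /=; congr (_ * _); apply: eq_bigr => p _.
  rewrite /W (sig_big_dep (J := fun n : 'I_N => 'I_(L n)) xpredT (fun _ _ => true)
    (fun (n : 'I_N) i => cos (2 * pi * (p.1%:R - p.2%:R) *
         (2 ^+ n * a - (window_start R K (c n) (s n) + i%:R) / K%:R)))) /=.
  by apply: eq_bigr => x _; congr cos; field; rewrite gt_eqF.
have tag_le (g : nat -> R) : (forall n, 0 <= g n) ->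
    \sum_(x : {n : 'I_N & 'I_(L n)}) g (tag x) <= 6 * K%:R * \sum_(0 <= n < N) g n.
  move=> g0.
  have <- : \sum_(n < N) \sum_(i < L n) g n =
      \sum_(x : {n : 'I_N & 'I_(L n)}) g (tag x).
    by rewrite (sig_big_dep (J := fun n : 'I_N => 'I_(L n)) xpredT
      (fun _ _ => true) (fun (n : 'I_N) _ => g n)).
  rewrite big_mkord mulr_sumr; apply: ler_sum => n _.
  by rewrite sumr_const card_ord -[leLHS]mulr_natl ler_wpM2r -?natrM ?ler_nat ?sK.
have Wle p : p.1 != p.2 -> (\sum_(a <- cantor_left R M) W p a ^+ 2) * j%:R ^+ 10
    <= 2 ^+ M * (6 * K%:R) ^+ 2 * (12 * N%:R ^+ 2).
  move=> p12; apply: le_trans (ler_wpM2r j0 (second_moment_cos _ _ _ M)) _.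
  set h := p.1%:Z - p.2%:Z.
  have h0 : h != 0 by rewrite subr_eq0 eqz_nat.
  have hK : (`|h| < K)%N.
    by rewrite /h; have := ltn_ord p.1; have := ltn_ord p.2; lia.
  have hE : h%:~R = p.1%:R - p.2%:R :> R by rewrite rmorphB.
  have r0 n n' : 0 <= riesz R M (h%:~R * (2 ^+ n - 2 ^+ n')) by exact: riesz_ge0.
  rewrite -[leLHS]mulrA -[leRHS]mulrA ler_wpM2l ?exprn_ge0 //.
  apply: le_trans (ler_wpM2l (sqr_ge0 (6 * K%:R)) (diff h h0 hK)).
  rewrite [leRHS]mulrA ler_wpM2r //.
  under eq_bigr => x _ do under eq_bigr => x' _ do rewrite -mulrBr -hE.
  apply: (@le_trans _ _ (\sum_(x : {n : 'I_N & 'I_(L n)}) 6 * K%:R *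
      \sum_(0 <= n' < N) riesz R M (h%:~R * (2 ^+ tag x - 2 ^+ n')))).
    apply: ler_sum => x _.
    exact: (tag_le (fun n' => riesz R M (h%:~R * (2 ^+ tag x - 2 ^+ n')))).
  rewrite -mulr_sumr [(6 * _) ^+ 2]expr2 -[leRHS]mulrA ler_wpM2l ?mulr_ge0 //.
  apply: (tag_le (fun n => \sum_(0 <= n' < N) riesz R M (h%:~R * (2 ^+ n - 2 ^+ n')))).
  by move=> n; rewrite sumr_ge0.
pose B : R := 2 ^+ M * (6 * K%:R) ^+ 2 * (12 * N%:R ^+ 2).
have B0 : 0 <= B by rewrite !mulr_ge0 ?exprn_ge0 ?sqr_ge0.
have pairs : \sum_(p : 'I_K * 'I_K | p.1 != p.2) (1 : R) <= K%:R ^+ 2.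
  rewrite sumr_const -natrX ler_nat; apply: leq_trans (max_card _) _.
  by rewrite card_prod card_ord.
have sqle : (\sum_(a <- cantor_left R M) discrepancy K c s N a ^+ 2) <=
    K%:R^-1 ^+ 4 * (K%:R ^+ 2 * \sum_(p : 'I_K * 'I_K | p.1 != p.2)
      \sum_(a <- cantor_left R M) W p a ^+ 2).
  rewrite exchange_big 2!mulr_sumr; apply: ler_sum => a _.
  rewrite discE exprMn -exprM ler_wpM2l ?exprn_ge0 ?invr_ge0 //.
  apply: le_trans (sqr_sum_le _ _ _ _ _) _.
  by rewrite ler_wpM2r // sumr_ge0 // => p _; rewrite sqr_ge0.
apply: le_trans (ler_wpM2r j0 sqle) _.
rewrite -[leLHS]mulrA -[X in _ * X <= _]mulrA mulr_suml.
apply: (@le_trans _ _ (K%:R^-1 ^+ 4 * (K%:R ^+ 2 * (K%:R ^+ 2 * B)))).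
  rewrite ler_wpM2l ?exprn_ge0 ?invr_ge0 // ler_wpM2l ?sqr_ge0 //.
  apply: (@le_trans _ _ (\sum_(p : 'I_K * 'I_K | p.1 != p.2) 1 * B)).
    by apply: ler_sum => p p12; rewrite mul1r; exact: Wle.
  by rewrite -mulr_suml ler_wpM2r.
rewrite le_eqVlt; apply/orP; left; apply/eqP; rewrite /B; field.
by rewrite gt_eqF.
Qed.

End variance.

(** * Bad intervals and the upper bound for hits *)

Section hits.
Variable R : realType.
Implicit Types (N j : nat) (y rho : nat -> R) (a c : R).

Definition hits y rho N a : R :=
  \sum_(n < N) (`[< near_int R (2 ^+ n * a - y n) (rho n) >])%:R.

(** The first two summands are what the variance bound asks for. The last one gives 2 ^ (j ^ 40) * 3
    ^ (- level j) <= 1 / j and makes the lengths of the intervals tend to 0. *)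
Definition level j : nat := (j ^ 3 * 2 ^ (j ^ 40) + j ^ 40 + j)%N.

(** The radius grows by 2 delta, as in [majorant_ge], with delta = 1 / j. Only upward deviations
    count as bad. *)
Definition bad_left j y rho : seq R := [seq c <- cantor_left R (level j) |
  (j ^ 40)%:R / j%:R <
  discrepancy R (j ^ 3) y (fun n => rho n + 2 * j%:R^-1) (j ^ 40) c].

Lemma window_size_level j (r : R) : (1 < j)%N -> 0 <= r <= 1 ->
  (window_size R (j ^ 3) (r + 2 * j%:R^-1) <= 6 * j ^ 3)%N.
Proof.
move=> j1 /andP[r0 r1].
have jV : 0 < (j%:R : R)^-1 <= 1 / 2.
  rewrite invr_gt0 ltr0n ltnW //= div1r lef_pV2 ?posrE ?ltr0n //; last exact: ltnW.
  by rewrite ler_nat.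
rewrite -(ler_nat R); apply: le_trans (window_size_le _ _ _ _) _; first by lra.
have : 1 <= (j ^ 3)%:R :> R by rewrite ler1n expn_gt0 ltnW.
by rewrite natrM; nra.
Qed.

(** Chebyshev's inequality. Of the saving j ^ 10 in the variance, j ^ 6 pays for K ^ 2 and j ^ 2 for
    the threshold; the remaining j ^ 2 makes the proportions summable. *)
Lemma size_bad_left j y rho : (1 < j)%N -> (forall n, 0 <= rho n <= 1) ->
  (size (bad_left j y rho))%:R * j%:R ^+ 2 <= 432 * 2 ^+ level j :> R.
Proof.
move=> j1 rho01; set s := fun n => rho n + 2 * j%:R^-1.
have := @discrepancy_variance R j (level j) y s j1
  (fun n => window_size_level j _ j1 (rho01 n)) (leq_addr _ _).
have N0 : 0 < ((j ^ 40)%:R : R) by rewrite ltr0n expn_gt0 ltnW.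
rewrite /bad_left -/s natrX; move: (level j) (j ^ 40)%N N0 => M N N0 var.
have j0 : 0 < (j%:R : R) by rewrite ltr0n ltnW.
have cheb : (size [seq c <- cantor_left R M |
    N%:R / j%:R < discrepancy R (j ^ 3) y s N c])%:R * (N%:R / j%:R) ^+ 2 <=
    \sum_(c <- cantor_left R M) discrepancy R (j ^ 3) y s N c ^+ 2.
  rewrite size_filter -sum1_count natr_sum mulr_suml big_mkcond /=.
  apply: ler_sum => c _; case: ifPn => [lt|_]; last by rewrite sqr_ge0.
  rewrite mul1r ler_sqr ?nnegrE ?(ltW lt) ?divr_ge0 // ltW //.
  by apply: le_lt_trans lt; rewrite divr_ge0.
move: (size _) cheb => z cheb.
have := le_trans (ler_wpM2r (exprn_ge0 10 (ltW j0)) cheb) var.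
have -> : z%:R * (N%:R / j%:R) ^+ 2 * j%:R ^+ 10 =
    (z%:R * j%:R ^+ 2) * (N%:R ^+ 2 * j%:R ^+ 6) :> R.
  by field; rewrite gt_eqF.
have -> : 432 * 2 ^+ M * (j%:R ^+ 3) ^+ 2 * N%:R ^+ 2 =
    (432 * 2 ^+ M) * (N%:R ^+ 2 * j%:R ^+ 6) :> R by ring.
by rewrite ler_pM2r // mulr_gt0 ?exprn_gt0.
Qed.

(** As 2 ^ n (a - c) <= 1 / j, a hit for a is a hit for c with radius enlarged by 1 / j. The error 8
    N / j adds 1 from the discrepancy, 2 from [majorant_ge], 4 from the widening of the arcs and 1
    from rounding the window sizes. *)
Lemma hits_le j y rho c a : (1 < j)%N -> (forall n, 0 <= rho n <= 1) ->
  c \in cantor_left R (level j) -> c \notin bad_left j y rho ->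
  c <= a <= c + 3^-1 ^+ level j ->
  hits y rho (j ^ 40) a <=
  \sum_(n < j ^ 40) 2 * rho n + 8 * ((j ^ 40)%:R / j%:R).
Proof.
move=> j1 rho01 cM; rewrite mem_filter cM andbT -leNgt => disc /andP[ca ac].
have j0 : 0 < (j%:R : R) by rewrite ltr0n ltnW.
have ac_le n : (n < j ^ 40)%N -> 2 ^+ n * (a - c) <= j%:R^-1.
  move=> nN; apply: (@le_trans _ _ (2 ^+ (j ^ 40) * 3^-1 ^+ level j)).
    rewrite ler_pM ?exprn_ge0 ?subr_ge0 //; last by lra.
    by rewrite ler_weXn2l // ?ler1n // ltnW.
  rewrite exprVn ler_pdivrMr ?exprn_gt0 // mulrC ler_pdivlMr //.
  rewrite -!natrX -natrM ler_nat /level.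
  apply: (@leq_trans (3 ^ (j ^ 40) * 3 ^ j)).
    apply: leq_mul; last exact: ltnW (ltn_expl _ _).
    by case: (j ^ 40)%N => // N; rewrite leq_exp2r.
  by rewrite -expnD leq_exp2l // -addnA leq_addl.
have K1 : j%:R <= ((j ^ 3)%:R : R).
  by rewrite ler_nat -[leqLHS]expn1 leq_exp2l.
have KV : ((j ^ 3)%:R : R)^-1 <= j%:R^-1.
  by rewrite lef_pV2 // posrE (lt_le_trans j0).
have K3 : 2 / ((j ^ 3)%:R * j%:R^-1 ^+ 2) = 2 * j%:R^-1 :> R.
  by rewrite natrX; field; rewrite gt_eqF.
move: (j ^ 40)%N ac_le disc => N ac_le disc.
have hit_le (n : 'I_N) : (`[< near_int R (2 ^+ n * a - y n) (rho n) >])%:R <=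
   majorant R (j ^ 3) (y n) (rho n + 2 * j%:R^-1) (2 ^+ n * c) + 2 * j%:R^-1.
  have /andP[rho0 rho1] := rho01 n.
  have := majorant_ge R (j ^ 3) (y n) j%:R^-1 (rho n) (2 ^+ n * c).
  rewrite K3; have := majorant_ge0 R (j ^ 3) (y n) (rho n + 2 * j%:R^-1) (2 ^+ n * c).
  case: asboolP => [[k]|_ maj0 _]; last by rewrite addr_ge0 ?divr_ge0.
  rewrite ler_norml => /andP[h1 h2] _ maj; rewrite -lerBlDr.
  apply: maj => //; first by rewrite expn_gt0 ltnW.
    by rewrite invr_gt0.
  exists k; have := ac_le n (ltn_ord n); rewrite mulrBr => h3.
  have h4 : 2 ^+ n * c <= 2 ^+ n * a by rewrite ler_wpM2l ?exprn_ge0.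
  by rewrite ler_norml; apply/andP; split; lra.
apply: (@le_trans _ _ (\sum_(n < N) (majorant R (j ^ 3) (y n)
    (rho n + 2 * j%:R^-1) (2 ^+ n * c) + 2 * j%:R^-1))).
  by apply: ler_sum => n _; exact: hit_le.
move: disc; rewrite /discrepancy sumrB big_split /= => disc.
have size_le : \sum_(n < N) (window_size R (j ^ 3) (rho n + 2 * j%:R^-1))%:R
    / (j ^ 3)%:R <= \sum_(n < N) 2 * rho n + N%:R * (5 * j%:R^-1) :> R.
  have -> : N%:R * (5 * j%:R^-1) = \sum_(n < N) (5 * j%:R^-1 : R).
    by rewrite sumr_const card_ord mulr_natl.
  rewrite -big_split /=; apply: ler_sum => n _; have /andP[rho0 rho1] := rho01 n.
  have K0 : 0 < ((j ^ 3)%:R : R) by exact: lt_le_trans K1.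
  have jV : 0 < (j%:R : R)^-1 by rewrite invr_gt0.
  have s0 : 0 <= rho n + 2 * j%:R^-1 by lra.
  rewrite ler_pdivrMr //; apply: le_trans (window_size_le _ _ _ s0) _.
  have : 1 <= j%:R^-1 * ((j ^ 3)%:R : R) by rewrite mulrC ler_pdivlMr ?mul1r.
  lra.
rewrite sumr_const card_ord -[X in _ + X <= _]mulr_natl.
lra.
Qed.

Lemma hits_cantor_le j y rho a : (1 < j)%N -> (forall n, 0 <= rho n <= 1) ->
  cantor_set R a ->
  (forall c, c \in bad_left j y rho -> ~ (c <= a <= c + 3^-1 ^+ level j)) ->
  hits y rho (j ^ 40) a <=
  \sum_(n < j ^ 40) 2 * rho n + 8 * ((j ^ 40)%:R / j%:R).
Proof.
move=> j1 rho01 /(_ (level j) I)/cantor_left_cover[c cM ca] nbad.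
by apply: (@hits_le j y rho c) => //; apply/negP => /nbad; exact.
Qed.

End hits.

(** * Null sets for Hausdorff measure *)

Section hausdorff_limsup.
Variable R : realType.

Lemma nneseries_le (f : (\bar R)^nat) (b : \bar R) :
  (forall i, 0 <= f i)%E -> (forall n, \sum_(0 <= i < n) f i <= b)%E ->
  (\sum_(0 <= i <oo) f i <= b)%E.
Proof.
move=> f0 fb; apply: lime_le; first by apply: is_cvg_nneseries => n _ _; exact: f0.
by apply: nearW => n; exact: fb.
Qed.

Lemma nneseries_pair (g : nat * nat -> \bar R)
    (f : {bij [set: nat] >-> [set: nat * nat]}) :
  (forall p, 0 <= g p)%E ->
  (\sum_(0 <= i <oo) g (f i) =
   \sum_(0 <= j <oo) \sum_(0 <= i <oo) g (j, i))%E.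
Proof.
move=> g0; rewrite nneseries_esumT // -(reindex_esum [set: nat] [set: nat * nat] f g).
  rewrite [RHS]nneseries_esumT => [|j]; last by rewrite nneseries_ge0.
  under [RHS]eq_esum => j _ do rewrite nneseries_esumT //.
  rewrite esum_esum // (_ : _ `*`` _ = setT); last by apply/seteqP; split.
  by apply: eq_esum => -[].
exact: 'bij_f.
Qed.

Lemma diam_itv (c w : R) : 0 <= w -> diam `[c, c + w]%classic = w%:E.
Proof.
move=> w0; apply/eqP; rewrite eq_le; apply/andP; split.
  apply: ge_ereal_sup => _ [[x y] [/= xc yc] <-].
  move: xc yc; rewrite !in_itv /= => /andP[? ?] /andP[? ?].
  by rewrite lee_fin ler_norml; apply/andP; split; lra.
apply: ereal_sup_ubound; exists (c + w, c) => /=.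
  by split; rewrite /= in_itv /=; apply/andP; split; lra.
by rewrite addrC addKr ger0_norm.
Qed.

Lemma diam_set0 : diam (@set0 R) = -oo%E.
Proof. by rewrite /diam set0X image_set0 ereal_sup0. Qed.

Lemma ln3_gt0 : 0 < ln 3 :> R.
Proof. by rewrite ln_gt0 // ltr1n. Qed.

Lemma dim_cantor_neq0 : ln 2 / ln 3 != 0 :> R.
Proof. by rewrite mulf_neq0 ?invr_eq0 ?gt_eqF ?ln3_gt0 ?ln_gt0 ?ltr1n. Qed.

Lemma powR_dim_cantor M : (3^-1 ^+ M : R) `^ (ln 2 / ln 3) = 2^-1 ^+ M.
Proof.
have ln3 := ln3_gt0; rewrite /powR gt_eqF ?exprn_gt0 ?invr_gt0 //.
rewrite -[RHS]lnK ?posrE ?exprn_gt0 ?invr_gt0 //; congr expR.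
rewrite !lnXn ?invr_gt0 // !lnV ?posrE //.
rewrite -[(- ln 3) *+ M]mulr_natr -[(- ln 2) *+ M]mulr_natr.
by field; rewrite gt_eqF.
Qed.

Lemma sum_inv_sqr_le J n : (0 < J)%N ->
  \sum_(0 <= j < n) (if (J < j)%N then (j%:R ^+ 2)^-1 else 0) <= J%:R^-1 :> R.
Proof.
move=> J0; have J0' : 0 < (J%:R : R) by rewrite ltr0n.
(* The sharper bound 1 / J - 1 / (n - 1) telescopes, since 1 / n ^ 2 <= 1 / (n - 1) - 1 / n. *)
apply: (@le_trans _ _ (if (J < n)%N then J%:R^-1 - n.-1%:R^-1 else 0)); last first.
  by case: ifP => _; rewrite ?invr_ge0 // lerBlDr lerDl invr_ge0.
elim: n => [|n IHn]; first by rewrite big_geq.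
rewrite big_nat_recr //= ltnS; move: IHn; case: ltngtP => [Jn|nJ|<-] IHn.
- apply: (@le_trans _ _ (J%:R^-1 - n.-1%:R^-1 + (n%:R ^+ 2)^-1)).
    by rewrite lerD2r.
  case: n Jn {IHn} => // n Jn /=.
  have n0 : 0 < (n%:R : R) by rewrite ltr0n (leq_trans J0).
  rewrite -natr1 -addrA lerD2l.
  have -> : - n%:R^-1 + ((n%:R + 1) ^+ 2)^-1 =
      - (n%:R + 1)^-1 - (n%:R * (n%:R + 1) ^+ 2)^-1 :> R.
    by field; lra.
  by rewrite gerDl oppr_le0 invr_ge0 mulr_ge0 ?sqr_ge0 // ltW.
- by rewrite addr0.
- by rewrite addr0 subrr.
Qed.

Variables (left : nat -> seq R) (level : nat -> nat) (C : R).

Definition cylinders (j : nat) : set R :=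
  \bigcup_(i < size (left j))
    `[nth 0 (left j) i, nth 0 (left j) i + 3^-1 ^+ level j]%classic.

Definition cylinders_limsup : set R :=
  \bigcap_(J : nat) \bigcup_(j in [set j | (J < j)%N]) cylinders j.

Lemma cylinders_limsup_measurable :
  measurable (cylinders_limsup : set (measurableTypeR R)).
Proof.
apply: bigcap_measurable => // J _; apply: bigcup_measurable => j _.
by apply: bigcup_measurable => i _; exact: measurable_itv.
Qed.

(** For every J the intervals of index j > J cover A. Each has weight 2 ^ (- level j), so index j
    contributes at most C / j ^ 2 and the whole cover at most C / J. *)
Lemma hausdorff_cylinders_limsup (A : set R) :
  (forall j, (1 < j)%N -> (size (left j))%:R * j%:R ^+ 2 <= C * 2 ^+ level j) ->
  (forall j, (j <= level j)%N) ->
  A `<=` cylinders_limsup ->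
  hausdorff (ln 2 / ln 3) A = 0%E.
Proof.
move=> size_le level_ge Asub; apply/eqP; rewrite eq_le; apply/andP; split; last first.
  apply: le_trans (ereal_sup_ubound _); last by exists 1; rewrite //= ltr01.
  apply: le_ereal_inf_tmp => _ [U _ <-]; apply: nneseries_ge0 => i _ _.
  exact: poweR_ge0.
apply: ge_ereal_sup => _ [delta /= delta0 <-].
apply/lee_addgt0Pr => e e0; rewrite add0e.
have C0 : 0 <= C.
  have := size_le 2%N isT; rewrite -ler_pdivrMr ?exprn_gt0 //; apply: le_trans.
  by rewrite divr_ge0 ?mulr_ge0 ?exprn_ge0.
have [J [J1 Jdelta Je]] : exists J, [/\ (1 < J)%N, 3^-1 ^+ J <= delta & C / J%:R <= e].
  have dV : 0 < delta^-1 by rewrite invr_gt0.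
  have Ce : 0 <= C / e by rewrite divr_ge0 // ltW.
  have := archi_boundP (addr_ge0 (ltW dV) Ce); set b := Num.bound _ => hb.
  have bJ : b%:R <= b.+2%:R :> R by rewrite ler_nat; lia.
  exists b.+2; split=> //.
    rewrite exprVn -[leRHS]invrK lef_pV2 ?posrE ?exprn_gt0 //.
    apply: (@le_trans _ _ b.+2%:R); first by lra.
    by rewrite -natrX ler_nat ltnW // ltn_expl.
  by rewrite ler_pdivrMr ?ltr0n // mulrC -ler_pdivrMr //; lra.
(* The finite families are padded with empty sets, of weight 0, so that a bijection of nat with nat
   * nat lists the cover as one sequence. *)
pose V p : set R := if (J < p.1)%N && (p.2 < size (left p.1))%N then
  `[nth 0 (left p.1) p.2, nth 0 (left p.1) p.2 + 3^-1 ^+ level p.1]%classic else set0.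
have /card_esym/ppcard_eqP[f] := card_nat2.
apply: (@le_trans _ _ (\sum_(0 <= i <oo) diam (V (f i)) `^ (ln 2 / ln 3))%E).
  apply: ereal_inf_lbound; exists (V \o f) => //; split=> [a /Asub /(_ J I)|i].
    move=> [j Jj [i /= ij aij]]; exists (f^-1%FUN (j, i)) => //=.
    by rewrite invK ?inE // /V Jj ij.
  rewrite /= /V; case: ifP => [/andP[Ji _]|_]; last by rewrite diam_set0 leNye.
  rewrite diam_itv ?exprn_ge0 ?invr_ge0 // lee_fin; apply: le_trans Jdelta.
  by rewrite ler_wiXn2l ?invr_ge0 // ?invf_le1 ?ler1n // (leq_trans (ltnW Ji)).
have diamE p : (diam (V p) `^ (ln 2 / ln 3) =
    (if (J < p.1)%N && (p.2 < size (left p.1))%N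
     then 2^-1 ^+ level p.1 else 0 : R)%:E)%E.
  rewrite /V; case: ifP => _; last by rewrite diam_set0 poweRNyr ?dim_cantor_neq0.
  by rewrite diam_itv ?exprn_ge0 ?invr_ge0 // poweR_EFin powR_dim_cantor.
rewrite (nneseries_pair (fun p => (diam (V p) `^ (ln 2 / ln 3))%E)); last first.
  by move=> p; exact: poweR_ge0.
have inner j : (\sum_(0 <= i <oo) diam (V (j, i)) `^ (ln 2 / ln 3) <=
    (C * (if (J < j)%N then (j%:R ^+ 2)^-1 else 0))%:E)%E.
  apply: nneseries_le => [i|n]; first exact: poweR_ge0.
  under eq_bigr => i _ do rewrite diamE /=.
  rewrite sumEFin lee_fin; case: ltnP => Jj /=; last by rewrite big1 ?mulr0.
  have j0 : 0 < (j%:R : R) by rewrite ltr0n (leq_trans _ Jj).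
  apply: (@le_trans _ _ ((size (left j))%:R * 2^-1 ^+ level j)).
    apply: (@le_trans _ _ ((minn n (size (left j)))%:R * 2^-1 ^+ level j)); last first.
      by rewrite ler_wpM2r ?exprn_ge0 ?invr_ge0 // ler_nat geq_minr.
    elim: n => [|n IHn]; first by rewrite big_geq // min0n mul0r.
    rewrite big_nat_recr //=; apply: le_trans (lerD IHn (lexx _)) _.
    case: ltnP => nL.
      by rewrite (minn_idPl nL) -[n.+1%:R]natr1; lra.
    by rewrite addr0 (minn_idPr (leqW nL)).
  rewrite exprVn ler_pdivrMr ?exprn_gt0 // mulrAC ler_pdivlMr ?exprn_gt0 //.
  exact: size_le (ltn_trans J1 Jj).
apply: le_trans (lee_nneseries _ (fun j _ => inner j)) _.
  by move=> j _ _; apply: nneseries_ge0 => i _ _; exact: poweR_ge0.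
apply: nneseries_le => [j|n].
  by rewrite lee_fin mulr_ge0 //; case: ifP => // _; rewrite invr_ge0 sqr_ge0.
rewrite sumEFin lee_fin -mulr_sumr; apply: le_trans Je.
by rewrite ler_wpM2l // sum_inv_sqr_le // ltnW.
Qed.

End hausdorff_limsup.

(** * Asymptotics between consecutive 40th powers *)

Section asymptotics.
Variable R : realType.
Implicit Types (n N j J : nat).

Definition hit_radius n : R := n%:R `^ (- (1 / 100)).

Lemma powR_root100 (z : R) : 0 <= z -> (z `^ (1 / 100)) ^+ 100 = z.
Proof.
move=> z0; rewrite -powR_mulrn ?powR_ge0 // -powRrM.
by rewrite (_ : 1 / 100 * 100%:R = 1) ?powRr1 //; field.
Qed.

Lemma root100_ge1 n : (0 < n)%N -> 1 <= (n%:R : R) `^ (1 / 100).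
Proof.
move=> n0; have : (1 : R) `^ (1 / 100) <= n%:R `^ (1 / 100).
  by rewrite ge0_ler_powR ?nnegrE ?ler1n //; lra.
by rewrite powR1.
Qed.

Lemma root100_ge (b : R) : exists n0, forall n, (n0 <= n)%N ->
  b <= (n%:R : R) `^ (1 / 100).
Proof.
have [b0|b0] := ltP b 0.
  by exists 0%N => n _; apply: le_trans (powR_ge0 _ _); exact: ltW.
exists (Num.bound (b ^+ 100)) => n bn.
have := archi_boundP (exprn_ge0 100 b0).
rewrite -(ler_nat R) in bn; move=> /(fun h => lt_le_trans h bn)/ltW {}bn.
rewrite -(@ler_pXn2r _ 100) ?nnegrE ?powR_ge0 //.
by rewrite powR_root100.
Qed.

Lemma hit_radius_ge0 n : 0 <= hit_radius n.
Proof. exact: powR_ge0. Qed.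

Lemma hit_radius_le1 n : hit_radius n <= 1.
Proof.
rewrite /hit_radius powRN; case: n => [|n].
  by rewrite powR0 ?invr0 //; lra.
by rewrite invf_le1 ?powR_gt0 // root100_ge1.
Qed.

Lemma radius_lt_half : exists n0, forall n, (n0 <= n)%N -> hit_radius n <= 1 / 2.
Proof.
have [n0 hn0] := root100_ge 2; exists n0 => n /hn0 n2.
by rewrite /hit_radius powRN [leRHS]div1r lef_pV2 ?posrE //; lra.
Qed.

Lemma sum_hit_radius_ge N : (0 < N)%N ->
  N%:R <= (N%:R : R) `^ (1 / 100) * \sum_(1 <= n < N.+1) hit_radius n.
Proof.
move=> N0; have t0 : 0 < (N%:R : R) `^ (1 / 100) by rewrite powR_gt0 ?ltr0n.
rewrite mulrC -ler_pdivrMr //.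
apply: (@le_trans _ _ (\sum_(1 <= n < N.+1) (N%:R `^ (1 / 100))^-1)).
  by rewrite sumr_const_nat subn1 /= -[leRHS]mulr_natl.
rewrite big_nat [leRHS]big_nat; apply: ler_sum => n /andP[n1 nN].
rewrite /hit_radius powRN lef_pV2 ?posrE ?powR_gt0 ?ltr0n //.
by rewrite ge0_ler_powR ?nnegrE ?ler_nat //; lra.
Qed.

(** For z = j and n = 39 this bounds the gap between j ^ 40 and (j + 1) ^ 40. *)
Lemma exprD1_le (z : R) n : 0 <= z ->
  (z + 1) ^+ n.+1 <= z ^+ n.+1 + n.+1%:R * (z + 1) ^+ n.
Proof.
move=> z0; elim: n => [|n IHn]; first by rewrite !expr1 expr0; lra.
have z1 : 0 <= z + 1 by lra.
rewrite exprS; apply: le_trans (ler_wpM2l z1 IHn) _.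
rewrite mulrDr mulrCA -exprS -[n.+2%:R]natr1 mulrDl mul1r mulrDl mul1r -exprS.
have : z ^+ n.+1 <= (z + 1) ^+ n.+1 by rewrite lerXn2r ?nnegrE //; lra.
lra.
Qed.

Lemma block_index N : (0 < N)%N -> exists j, (j ^ 40 <= N < j.+1 ^ 40)%N.
Proof.
move=> N0; have ex0 : exists j, (j ^ 40 <= N)%N by exists 0%N; rewrite exp0n.
have bnd j : (j ^ 40 <= N -> j <= N)%N.
  apply: leq_trans; case: j => // j.
  by rewrite -[leqLHS]expn1; apply: leq_pexp2l.
have [j jN jmax] := ex_maxnP ex0 bnd; exists j; rewrite jN /= ltnNge.
by apply/negP => /jmax; rewrite ltnn.
Qed.

(* With t = N ^ (1/100) and N < (2 j) ^ 40 one has t ^ 5 <= (2 j) ^ 2, so the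
   error j ^ 39 <= N / j is smaller than N / t by a factor of order t. *)
Lemma cvg_count_ratio (count : nat -> R) (C : R) J : 0 <= C ->
  (forall j N, (J < j)%N -> (j ^ 40 <= N < j.+1 ^ 40)%N ->
    `|count N - 2 * \sum_(1 <= n < N.+1) hit_radius n| <= C * j.+1%:R ^+ 39) ->
  count N / (2 * \sum_(1 <= n < N.+1) hit_radius n) @[N --> \oo] --> (1 : R).
Proof.
move=> C0 count_le; apply/cvgrPdist_le => e e0.
(* From n0 on, C 2 ^ 39 <= t e; the factor 2 ^ 39 comes from (j + 1) ^ 39 <= (2 j) ^ 39. *)
have [n0 hn0] := root100_ge (C * 2 ^+ 39 / e).
exists (n0 + J.+1 ^ 40)%N => // N /= hN.
have N0 : (0 < N)%N by apply: leq_trans hN; rewrite addn_gt0 expn_gt0 orbT.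
have [j /andP[jN Nj]] := block_index N N0.
have Jj : (J < j)%N.
  rewrite -ltnS -(@ltn_exp2r _ _ 40) //; apply: leq_ltn_trans Nj.
  by apply: leq_trans hN; exact: leq_addl.
have j0 : 0 < (j%:R : R) by rewrite ltr0n (leq_trans _ Jj).
have j1 : 1 <= (j%:R : R) by rewrite ler1n (leq_trans _ Jj).
have := hn0 N (leq_trans (leq_addr _ _) hN).
have := root100_ge1 N N0; have := powR_root100 N%:R (ler0n R N).
have := sum_hit_radius_ge N N0.
set t := _ `^ _; set S := \sum_(_ <= _ < _) _ => hS tN t1 tC.
have S0 : 0 < S.
  have : 0 < t * S by apply: lt_le_trans hS; rewrite ltr0n.
  by rewrite pmulr_rgt0 //; lra.
(* A weaker power suffices: t ^ 80 <= t ^ 100 = N < (j + 1) ^ 40 <= (2 j) ^ 40. *)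
have t2 : t ^+ 2 <= 2 * j%:R.
  rewrite -(@ler_pXn2r _ 40) ?nnegrE ?exprn_ge0 ?mulr_ge0 //; last by lra.
  rewrite -exprM; apply: (@le_trans _ _ (t ^+ 100)); first by rewrite ler_weXn2l.
  rewrite tN; apply: (@le_trans _ _ (j.+1 ^ 40)%:R).
    by rewrite ler_nat ltnW.
  rewrite natrX lerXn2r ?nnegrE ?mulr_ge0 // -natr1; lra.
have jS : j%:R ^+ 40 <= t * S.
  by apply: le_trans hS; rewrite -natrX ler_nat.
have j39 : j.+1%:R ^+ 39 <= 2 ^+ 39 * j%:R ^+ 39 :> R.
  by rewrite -exprMn lerXn2r ?nnegrE ?mulr_ge0 // -natr1; lra.
have {}count_le := count_le j N Jj (introT andP (conj jN Nj)).
rewrite -/S in count_le.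
have -> : 1 - count N / (2 * S) = - ((count N - 2 * S) / (2 * S)).
  by field; rewrite gt_eqF.
rewrite normrN normrM [`|(2 * S)^-1|]gtr0_norm ?invr_gt0 ?mulr_gt0 //.
rewrite ler_pdivrMr ?mulr_gt0 //; apply: le_trans count_le _.
apply: le_trans (ler_wpM2l C0 j39) _.
have t0 : 0 < t by lra.
(* After multiplication by t the chain is t C 2 ^ 39 j ^ 39 <= t ^ 2 e j ^ 39 <= 2 e j ^ 40 <= 2 e t
   S. *)
rewrite -(ler_pM2l t0); rewrite ler_pdivrMr // in tC.
rewrite [C * _]mulrA; move: (2 ^+ 39 : R) tC => D tC.
have jX : j%:R ^+ 40 = j%:R * j%:R ^+ 39 :> R by rewrite exprS.
have P0 : 0 <= (j%:R : R) ^+ 39 by rewrite exprn_ge0.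
rewrite jX in jS; move: (_ ^+ 39) P0 jS {jX j39} => P P0 jS.
apply: (@le_trans _ _ (t * (t * e * P))).
  by rewrite ler_wpM2l ?(ltW t0) // ler_wpM2r.
apply: (@le_trans _ _ (2 * j%:R * (e * P))).
  rewrite (_ : t * (t * e * P) = t ^+ 2 * (e * P)); last by ring.
  by rewrite ler_wpM2r // mulr_ge0 // ltW.
rewrite (_ : 2 * j%:R * (e * P) = 2 * e * (j%:R * P)); last by ring.
rewrite (_ : t * (e * (2 * S)) = 2 * e * (t * S)); last by ring.
by rewrite ler_wpM2l // mulr_ge0 // ltW.
Qed.

End asymptotics.

(** * Counting hits *)

Section counting.
Variable R : realType.
Implicit Types (x : nat -> circle R) (n N j J : nat) (a u v : R).

Lemma circle_dist_near_int u v (rho : R) :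
  circle_dist (to_circle u) (to_circle v) <= rho <-> near_int R (u - v) rho.
Proof.
split=> [|[k uvk]]; last exact: le_trans (circle_dist_le u v k) uvk.
by have [k ->] := circle_dist_attained u v; exists k.
Qed.

Lemma iter_doubling n a :
  iter n (@doubling R) (to_circle a) = to_circle (2 ^+ n * a).
Proof.
elim: n => [|n IHn]; first by rewrite mul1r.
by rewrite iterS IHn to_circle_double exprS mulrA.
Qed.

Lemma hit_countE x a N : (hit_count x a N)%:R =
  \sum_(n < N.+1) ((0 < n)%N &&
     `[< near_int R (2 ^+ n * a - repr (x n)) (hit_radius R n) >])%:R :> R.
Proof.
rewrite /hit_count -sum1_card natr_sum big_mkcond /=; apply: eq_bigr => n _.
rewrite inE /= iter_doubling.
have -> : 1 / n%:R `^ (1 / 100) = hit_radius R n.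
  by rewrite /hit_radius powRN [LHS]div1r.
suff -> : (circle_dist (to_circle (2 ^+ n * a)) (x n) <= hit_radius R n) =
    `[< near_int R (2 ^+ n * a - repr (x n)) (hit_radius R n) >].
  by case: (_ && _).
have {1}-> : x n = to_circle (repr (x n)) by rewrite /to_circle reprK.
by apply/idP/asboolP => /circle_dist_near_int.
Qed.

(** If f is the fractional part of z, then r < f and r < 1 - f, so |f - 1/2| < 1/2 - r: the
    complement of an arc lies in an arc about the antipode. *)
Lemma near_int_antipode (z r : R) : ~ near_int R z r ->
  near_int R (z - 1 / 2) (Num.max 0 (1 / 2 - r)).
Proof.
move=> nz; exists (- Num.floor z); rewrite rmorphN /=.
have f1 := floor_le z; have f2 := floorD1_gt z; rewrite intrD1 in f2.
have h1 : r < `|z + (- Num.floor z)%:~R|.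
  by rewrite ltNge; apply/negP => h; apply: nz; exists (- Num.floor z).
have h2 : r < `|z + (- Num.floor z - 1)%:~R|.
  by rewrite ltNge; apply/negP => h; apply: nz; exists (- Num.floor z - 1).
rewrite rmorphN /= ger0_norm in h1; last by lra.
rewrite rmorphB rmorphN /= ler0_norm in h2; last by lra.
by rewrite le_max; apply/orP; right; rewrite ler_norml; apply/andP; split; lra.
Qed.

Definition centre x n : R := repr (x n).
Definition antipode x n : R := repr (x n) + 1 / 2.
(** The truncation at 0 concerns the small n with [hit_radius] above 1/2 and keeps the radius in
    [0, 1], as [hits_cantor_le] demands. *)
Definition coradius n : R := Num.max 0 (1 / 2 - hit_radius R n).

Lemma coradius_itv n : 0 <= coradius n <= 1.
Proof.
rewrite /coradius le_max lexx ge_max ler01 /=.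
by have := hit_radius_ge0 R n; lra.
Qed.

Lemma hit_radius_itv n : 0 <= hit_radius R n <= 1.
Proof. by rewrite hit_radius_ge0 hit_radius_le1. Qed.

Lemma hit_count_le x a N N' : (N < N')%N ->
  (hit_count x a N)%:R <= hits R (centre x) (hit_radius R) N' a.
Proof.
move=> NN'; rewrite hit_countE /hits.
rewrite -(big_mkord xpredT (fun n => ((0 < n)%N &&
     `[< near_int R (2 ^+ n * a - repr (x n)) (hit_radius R n) >])%:R)).
rewrite -(big_mkord xpredT (fun n =>
     (`[< near_int R (2 ^+ n * a - centre x n) (hit_radius R n) >])%:R)).
rewrite [leRHS](big_cat_nat _ (n := N.+1)) //= -[leLHS]addr0 lerD ?sumr_ge0 //.
by apply: ler_sum => n _; rewrite ler_nat; case: (0 < n)%N.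
Qed.

(** Each n from 1 to N is a hit either of the arc or of the complementary one, so an upper bound on
    the latter hits is a lower bound on [hit_count]. *)
Lemma hit_count_ge x a N N' : (N < N')%N ->
  N%:R <= (hit_count x a N)%:R + hits R (antipode x) coradius N' a.
Proof.
move=> NN'; rewrite hit_countE /hits.
rewrite -(big_mkord xpredT (fun n => ((0 < n)%N &&
     `[< near_int R (2 ^+ n * a - repr (x n)) (hit_radius R n) >])%:R)).
rewrite -(big_mkord xpredT (fun n =>
     (`[< near_int R (2 ^+ n * a - antipode x n) (coradius n) >])%:R)).
apply: (@le_trans _ _ (\sum_(0 <= n < N.+1) (0 < n)%N%:R)).
  rewrite big_nat_recl //= add0r.
  by rewrite sumr_const_nat subn0.
rewrite [X in _ + X](big_cat_nat _ (n := N.+1)) //= addrA -big_split /=.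
rewrite -[leLHS]addr0 lerD ?sumr_ge0 //; apply: ler_sum => n _.
case: (0 < n)%N => /=; last by rewrite add0r.
case: asboolP => [_|/near_int_antipode near_anti].
  by rewrite lerDl.
by rewrite add0r asboolT // /antipode opprD addrA.
Qed.

Lemma sum_hit_radius_extend N N' : (N < N')%N ->
  2 * \sum_(1 <= n < N.+1) hit_radius R n <= \sum_(n < N') 2 * hit_radius R n <=
  2 * \sum_(1 <= n < N.+1) hit_radius R n + 2 * (N'%:R - N%:R).
Proof.
move=> NN'; rewrite -mulr_sumr -(big_mkord xpredT (hit_radius R)).
(* A zero base with nonzero exponent has power 0, so the term n = 0 adds nothing. *)
have r0 : hit_radius R 0 = 0.
  by rewrite /hit_radius powR0 //; lra.
have -> : \sum_(0 <= n < N') hit_radius R n =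
    \sum_(1 <= n < N.+1) hit_radius R n + \sum_(N.+1 <= n < N') hit_radius R n.
  by rewrite big_ltn ?(leq_trans _ NN') // r0 add0r (big_cat_nat _ (n := N.+1)).
rewrite mulrDr lerDl lerD2l.
rewrite pmulr_rge0 // sumr_ge0 => [|n _]; last exact: hit_radius_ge0.
rewrite ler_pM2l //=; apply: (@le_trans _ _ (\sum_(N.+1 <= n < N') 1)).
  by apply: ler_sum => n _; exact: hit_radius_le1.
rewrite sumr_const_nat natrB // -[N.+1%:R]natr1; lra.
Qed.

(** Once [hit_radius] is at most 1/2, twice [coradius] is exactly 1 - 2 [hit_radius]; each of the n0
    earlier terms costs at most 1. *)
Lemma sum_coradius_le : exists C : R, 0 <= C /\ forall N,
  \sum_(n < N) 2 * coradius n <= N%:R - \sum_(n < N) 2 * hit_radius R n + C.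
Proof.
have [n0 hn0] := radius_lt_half R; exists n0%:R; split=> // N.
suff : \sum_(0 <= n < N) 2 * coradius n <=
    N%:R - \sum_(0 <= n < N) 2 * hit_radius R n + (minn N n0)%:R.
  rewrite !big_mkord; move=> /le_trans; apply.
  by rewrite lerD2l ler_nat geq_minr.
elim: N => [|N IHN]; first by rewrite !big_geq // min0n; lra.
rewrite !big_nat_recr //= -[N.+1%:R]natr1.
have [Nn0|n0N] := ltnP N n0.
  rewrite (minn_idPl (ltnW Nn0)) in IHN.
  rewrite (minn_idPl Nn0) -[X in _ <= _ + X]natr1.
  rewrite /coradius; have := hit_radius_le1 R N; have := hit_radius_ge0 R N.
  by case: (leP 0 (1 / 2 - hit_radius R N)) => /=; lra.
rewrite (minn_idPr n0N) in IHN; rewrite (minn_idPr (leqW n0N)).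
rewrite /coradius max_r; first by lra.
by have := hn0 N n0N; lra.
Qed.

(** Compare N with the end N' = (j + 1) ^ 40 of its block, where N' - N <= 40 (j + 1) ^ 39. The
    upper bound loses 2 (N' - N) and the error 8 N' / (j + 1), hence 88; the lower bound, from the
    complementary arcs, loses N' - N, the same error and C. *)
Lemma hit_count_error x a (C : R) j N : (1 < j)%N ->
  (forall N, \sum_(n < N) 2 * coradius n <=
     N%:R - \sum_(n < N) 2 * hit_radius R n + C) -> 0 <= C ->
  (j ^ 40 <= N < j.+1 ^ 40)%N ->
  hits R (centre x) (hit_radius R) (j.+1 ^ 40) a <=
    \sum_(n < j.+1 ^ 40) 2 * hit_radius R n + 8 * ((j.+1 ^ 40)%:R / j.+1%:R) ->
  hits R (antipode x) coradius (j.+1 ^ 40) a <=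
    \sum_(n < j.+1 ^ 40) 2 * coradius n + 8 * ((j.+1 ^ 40)%:R / j.+1%:R) ->
  `|(hit_count x a N)%:R - 2 * \sum_(1 <= n < N.+1) hit_radius R n| <=
    (88 + C) * j.+1%:R ^+ 39.
Proof.
move=> j1 hC C0 /andP[jN Nj]; have hN := hC (j.+1 ^ 40)%N.
have := sum_hit_radius_extend N _ Nj.
have := hit_count_le x a N _ Nj; have := hit_count_ge x a N _ Nj.
have N'le : (j.+1 ^ 40)%:R <= N%:R + 40 * j.+1%:R ^+ 39 :> R.
  have := exprD1_le R j%:R 39 (ler0n R j); rewrite natr1 -!natrX.
  have : (j ^ 40)%:R <= N%:R :> R by rewrite ler_nat.
  lra.
have j39 : 1 <= (j.+1%:R : R) ^+ 39 by rewrite exprn_ege1 // ler1n.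
have -> : (j.+1 ^ 40)%:R / j.+1%:R = j.+1%:R ^+ 39 :> R.
  by rewrite natrX exprSr mulfK // pnatr_eq0.
have NN' : N%:R <= (j.+1 ^ 40)%:R :> R by rewrite ler_nat ltnW.
move: (j.+1 ^ 40)%N N'le NN' hN => N' N'le NN' hN.
move: (hits _ _ _ _ _) (hits _ _ _ _ _) => h1 h2 ge le /andP[S1 S2] le1 le2.
have CP : C <= C * j.+1%:R ^+ 39 by rewrite ler_peMr.
move: (_ ^+ 39) CP N'le j39 le1 le2 => P CP N'le P1 le1 le2.
by rewrite ler_norml; apply/andP; split; lra.
Qed.

End counting.

Theorem theorem1p5 (R : realType) (x : nat -> circle R) :
  {ae cantor_measure R, forall a : R, cantor_set R a ->
    (hit_count x a N)%:R / (2 * \sum_(1 <= n < N.+1) n%:R `^ (- (1 / 100)))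
      @[N --> \oo] --> (1 : R)}.
Proof.
pose left j := bad_left R j (centre R x) (hit_radius R) ++
  bad_left R j (antipode R x) (coradius R).
exists (cylinders_limsup R left level); split.
- exact: cylinders_limsup_measurable.
- apply: (@hausdorff_cylinders_limsup R left level 864) => [j j1|j|a [] //].
    have h1 := size_bad_left R j (centre R x) _ j1 (hit_radius_itv R).
    have h2 := size_bad_left R j (antipode R x) _ j1 (coradius_itv R).
    by rewrite size_cat natrD; lra.
  by rewrite /level leq_addl.
move=> a /= /not_implyP[aC ncvg]; apply: contrapT => alim; apply: ncvg.
(* A point outside the limsup avoids all bad intervals from some index on. *)
have [J good] : exists J, forall j, (J < j)%N -> ~ cylinders R left level j a.
  apply: contrapT => nJ; apply: alim => J _; apply: contrapT => nj.
  by apply: nJ; exists J => j Jj aj; apply: nj; exists j.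
have {}good j c : (J < j)%N -> c \in left j -> ~ (c <= a <= c + 3^-1 ^+ level j).
  move=> /good ncyl cj ca; apply: ncyl; exists (index c (left j)) => /=.
    by rewrite index_mem.
  by rewrite nth_index // in_itv.
have [C [C0 hC]] := sum_coradius_le R.
(* Starting at J.+1 ensures 1 < j as well. *)
apply: (@cvg_count_ratio R (fun N => (hit_count x a N)%:R) (88 + C) J.+1).
  by rewrite addr_ge0.
move=> j N Jj; have [j1 j2 {}Jj] : [/\ 1 < j, 1 < j.+1 & J < j.+1]%N by split; lia.
move=> jN; apply: hit_count_error => //.
- apply: hits_cantor_le => //; first exact: hit_radius_itv.
  by move=> c cj; apply: good; [exact: Jj | rewrite mem_cat cj].
- apply: hits_cantor_le => //; first exact: coradius_itv.
  by move=> c cj; apply: good; [exact: Jj | rewrite mem_cat cj orbT].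
Qed.
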